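(* Let $\Omega=\mathbb{T}^3$ or $\Omega=\Omega_0$. For $h_1,h_2\in\mathbb{R}\setminus\{0\}$, if there exists a minimizer $(B,\omega)$ of $$\left\{\int_{\Omega}\left(|u(x)|^2+|B(x)|^2\right)dx:\ (B,\omega)\in\mathcal{A}^{h_1,h_2}(\Omega)\right\}$$ over $\mathcal{A}^{h_1,h_2}(\Omega)$, then the minimizer $(B,\omega)=(B,\nabla\times u)$ satisfies $$u=\lambda_2(B+\omega),\qquad u-J=-\lambda_1B$$ for some Lagrange multipliers $\lambda_1,\lambda_2\in\mathbb{R}$.
   Context: $\mathbb{T}^3=[-\pi,\pi]^3$ is the periodic domain, and $\Omega_0$ is an open and bounded domain with zero boundary condition. Define $$L^2_{\mathrm{curl}}(\Omega)=\{B\in L^2(\Omega): B=\nabla\times A,\ A\in L^2(\Omega)\}.$$ Here $B=\nabla\times A$, $\omega=\nabla\times u$ and $J=\nabla\times B$. The magnetic helicity and the magneto-vorticity helicity are $$\mathcal{H}_B=\int_\Omega A\cdot B\,dx,\qquad \mathcal{H}_{B+\omega}=\int_\Omega (A+u)\cdot(B+\omega)\,dx,$$ and, for constants $h_1,h_2$, $$\mathcal{A}^{h_1,h_2}(\Omega)=\{(B,\omega)\in L^2_{\mathrm{curl}}(\Omega):\ \mathcal{H}_B=h_1,\ \mathcal{H}_{B+\omega}=h_2\},$$ where $(B,\omega)\in L^2_{\mathrm{curl}}(\Omega)$ means that both $B$ and $\omega$ belong to $L^2_{\mathrm{curl}}(\Omega)$. *)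

(* Defs.v *)
From HB Require Import structures.
From mathcomp Require Import all_boot all_order all_algebra.
From mathcomp Require Import all_classical all_reals all_analysis.
Import Order.TTheory GRing.Theory Num.Theory.
Import numFieldNormedType.Exports.

Set Implicit Arguments.
Unset Strict Implicit.
Unset Printing Implicit Defensive.

Local Open Scope classical_set_scope.
Local Open Scope ring_scope.

Definition R3 (R : realType) := (R * R * R)%type.

Definition pt_coord (R : realType) (x : R3 R) (i : 'I_3) : R :=
  if i == 0 then x.1.1 else if i == 1 then x.1.2 else x.2.

Definition axis_vec (R : realType) (i : 'I_3) : R3 R :=
  ((i == 0)%:R, (i == 1)%:R, (i == 2%:R)%:R).

(* The same set as R3 R, carrying the product Borel sigma-algebra on which
   lebesgue_measure is declared. *)
Definition R3m (R : realType) :=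
  (measurableTypeR R * measurableTypeR R * measurableTypeR R)%type.

Definition lebesgue3 (R : realType) : {measure set (R3m R) -> \bar R} :=
  ((@lebesgue_measure R \x @lebesgue_measure R) \x @lebesgue_measure R)%E.

(* Fields are functions on all of R^3; only their restriction to the region
   under consideration, up to null sets, is ever used. *)
Definition vfield (R : realType) := 'I_3 -> R3 R -> R.

Definition vadd (R : realType) (F G : vfield R) : vfield R :=
  fun i x => F i x + G i x.

Definition dot (R : realType) (F G : vfield R) (x : R3 R) : R :=
  \sum_(i < 3) F i x * G i x.

Fixpoint Ck (R : realType) (k : nat) (f : R3 R -> R) : Prop :=
  if k is k'.+1 then
    continuous f /\
    forall i, (forall x, derivable f x (axis_vec R i)) /\
              Ck k' (fun x => 'D_(axis_vec R i) f x)
  else continuous f.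

Definition smooth (R : realType) (F : vfield R) : Prop :=
  forall k i, Ck k (F i).

(* Indices are taken modulo 3 in 'I_3, so that component i is
   d_(i+1) F_(i+2) - d_(i+2) F_(i+1). *)
Definition curl (R : realType) (F : vfield R) : vfield R := fun i x =>
  'D_(axis_vec R (i + 1)) (F (i + 2%:R)) x - 'D_(axis_vec R (i + 2%:R)) (F (i + 1)) x.

Definition periodic2pi (R : realType) (F : vfield R) : Prop :=
  forall i j x, F i (x + (2 * pi) *: axis_vec R j) = F i x.

Definition compactly_supported_in (R : realType) (U : set (R3 R))
    (F : vfield R) : Prop :=
  exists K : set (R3 R), [/\ compact K, K `<=` U &
    forall i x, ~ K x -> F i x = 0].

Inductive region (R : realType) :=
| Torus
| Domain of set (R3 R).

Arguments Torus {R}.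

Definition wf_region (R : realType) (Om : region R) : Prop :=
  match Om with
  | Torus => True
  | Domain U => [/\ open U, connected U, U !=set0 & bounded_set U]
  end.

Definition carrier (R : realType) (Om : region R) : set (R3 R) :=
  match Om with
  | Torus => [set x | forall i, - pi <= pt_coord x i <= pi]
  | Domain U => U
  end.

Definition test_field (R : realType) (Om : region R) (F : vfield R) : Prop :=
  match Om with
  | Torus => smooth F /\ periodic2pi F
  | Domain U => smooth F /\ compactly_supported_in U F
  end.

(* On a bounded domain these are smooth up to, and need not vanish on, the
   boundary. *)
Definition test_field_bc (R : realType) (Om : region R) (F : vfield R) : Prop :=
  match Om with
  | Torus => smooth F /\ periodic2pi F
  | Domain _ => smooth F
  end.

Definition L2 (R : realType) (Om : region R) (F : vfield R) : Prop :=
  forall i, measurable_fun (carrier Om : set (R3m R)) (F i : R3m R -> R) /\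
    (lebesgue3 R).-integrable (carrier Om) (fun x => (F i x ^+ 2)%:E).

Definition inner (R : realType) (Om : region R) (F G : vfield R) : R :=
  \int[lebesgue3 R]_(x in carrier Om) dot F G x.

(* The distributional identity curl F = G, without boundary condition. *)
Definition is_curl (R : realType) (Om : region R) (F G : vfield R) : Prop :=
  forall phi, test_field Om phi -> inner Om F (curl phi) = inner Om G phi.

(* curl F = G together with the zero boundary condition on F.  For smooth F on a
   smooth domain, Green's formula gives
     int F . curl phi - int (curl F) . phi = int_boundary (F x n) . phi,
   so the absence of a boundary term for every phi smooth up to the boundary
   says exactly that the trace F x n vanishes (equivalently, the extension of F
   by 0 has as curl the extension of G by 0).  This is the only trace of F that
   is meaningful when just F and curl F are in L^2.  It makes both helicities
   below independent of the choice of the potentials. *)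
Definition is_curl_bc (R : realType) (Om : region R) (F G : vfield R) : Prop :=
  forall phi, test_field_bc Om phi -> inner Om F (curl phi) = inner Om G phi.

Definition potential (R : realType) (Om : region R) (B A : vfield R) : Prop :=
  L2 Om A /\ is_curl_bc Om A B.

Definition L2curl (R : realType) (Om : region R) : set (vfield R) :=
  [set B | L2 Om B /\ exists A, potential Om B A].

Definition helicity_class (R : realType) (Om : region R) (h1 h2 : R) :
    set (vfield R * vfield R) :=
  [set Bw | [/\ L2curl Om Bw.1, L2curl Om Bw.2 &
    exists A u, [/\ potential Om Bw.1 A, potential Om Bw.2 u,
      inner Om A Bw.1 = h1 &
      inner Om (vadd A u) (vadd Bw.1 Bw.2) = h2]]].

Definition energy (R : realType) (Om : region R) (u B : vfield R) : R :=
  \int[lebesgue3 R]_(x in carrier Om) (dot u u x + dot B B x).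

(* The energy involves a velocity u with curl u = w, and w determines u only up
   to a curl-free field; the minimum is taken over all such velocities.  A
   minimizing u is thus L^2-orthogonal to the curl-free fields, that is,
   divergence-free (and of zero mean on the torus). *)
Definition is_minimizer (R : realType) (Om : region R) (h1 h2 : R)
    (B w u : vfield R) : Prop :=
  [/\ helicity_class Om h1 h2 (B, w), potential Om w u &
    forall B' w' u', helicity_class Om h1 h2 (B', w') -> potential Om w' u' ->
      energy Om u B <= energy Om u' B'].

(* Main.v *)
(* Perturb the minimizer by test fields: [A + a], [B + curl a], [u + v],
   [w + curl v].  Since test fields are admissible in both the definition of a
   potential and the variational identity, the two helicities change by
   [2 <B, a> + <a, curl a>] and [2 <B + w, a + v> + <a + v, curl (a + v)>],
   without any symmetry of curl on L^2 potentials.  As [h1] and [h2] are nonzero,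
   so are [B] and [B + w], hence some [a1], [v2] have [<B, a1> = <B + w, v2> = 1];
   correcting a variation along [(a1, - a1)] and [(0, v2)] decouples the two
   constraints into scalar quadratic equations with roots of second order.  The
   first variation of the energy is therefore a combination of the two linear
   forms, and [J := lambda1 B + u] is the curl of [B] by definition.  It remains
   that an L^2 field orthogonal to all test fields vanishes: products of smooth
   one-dimensional cut-offs converge to indicators of boxes, and boxes generate
   the Borel sets. *)

Require Import Defs.
From HB Require Import structures.
From mathcomp Require Import all_boot all_order all_algebra.
From mathcomp Require Import ring lra.
From mathcomp Require Import all_classical all_reals all_analysis.
From mathcomp Require Import measurable_realfun.
Import Order.TTheory GRing.Theory Num.Theory.
Import numFieldNormedType.Exports.

Set Implicit Arguments.
Unset Strict Implicit.
Unset Printing Implicit Defensive.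

Local Open Scope classical_set_scope.
Local Open Scope ring_scope.

(** * Smooth functions and cut-offs *)

Section SmoothCalculus.
Variable R : realType.
Implicit Types (f g h : R3 R -> R) (x v : R3 R) (t : R).

(** Competitors must satisfy two quadratic constraints exactly, not merely to first order. The
    direction [(a1, - a1)] leaves [a + v] unchanged, so it moves the first constraint only, while
    [(0, v2)] moves the second only. The variation [(a, v)] under test lies in the kernel of both
    linear forms, so its size [s] enters each constraint without a linear term, whereas the
    normalised pairings give each correction parameter the linear coefficient 2, up to [O(s)]. The
    corrections are thus [O(s^2)], and since [s] may have either sign the first variation must
    vanish. The multipliers are the values of half the first variation of the energy along
    [(a1, - a1)] and [(0, v2)].

    No derivative ever falls on [A], [B], [w] or [u], which are only square-integrable: each curl is
    carried by a smooth field. The velocity [u0] that witnesses the second helicity may differ from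
    the minimizing velocity [u]; both are shifted by the same [v]. *)

Lemma is_derive_line f x v :
  derivable f x v -> is_derive (0 : R) 1 (fun t : R => f (t *: v + x)) ('D_v f x).
Proof.
move=> fxv; have d := (derivable1P f x v).1 fxv.
apply: DeriveDef => //.
rewrite /derive; set g1 := fun t => t^-1 *: _; set g2 := fun t => t^-1 *: _.
suff -> : g1 = g2 by [].
by rewrite funeqE /g1 /g2 => t /=; rewrite addr0 scale0r add0r [_%:A]mulr1.
Qed.

(** Only directional derivatives of [h] are at hand, so the chain rule is taken in one variable,
    along the line through [x] in the direction [v]. *)
Lemma is_derive_comp1 (T T' : R -> R) h x v :
  (forall t, is_derive t 1 T (T' t)) -> derivable h x v ->
  is_derive x v (T \o h) (T' (h x) * 'D_v h x).
Proof.
move=> dT dh.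
have dl := is_derive_line dh.
have e0 : h x = h ((0 : R) *: v + x) by rewrite scale0r add0r.
have dTx : is_derive (h ((0 : R) *: v + x)) 1 T (T' (h x)) by rewrite -e0.
have dc := @is_derive1_comp _ _ _ _ _ _ dTx dl.
have dd : derivable (T \o h) x v by apply/derivable1P; have [] := dc.
apply: DeriveDef => //.
by have [_ <-] := is_derive_line dd; have [_ <-] := dc.
Qed.

Lemma Ck_continuous k f : Ck k f -> continuous f.
Proof. by case: k => [//|k] []. Qed.

Lemma Ck_derivable k f x i : Ck k.+1 f -> derivable f x (axis_vec R i).
Proof. by move=> [_ /(_ i)[]]. Qed.

Lemma Ck_derive k f i : Ck k.+1 f -> Ck k (fun x => 'D_(axis_vec R i) f x).
Proof. by move=> [_ /(_ i)[]]. Qed.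

Lemma CkW k f : Ck k.+1 f -> Ck k f.
Proof.
elim: k f => [|k IH] f cf; first exact: Ck_continuous cf.
split; first exact: Ck_continuous cf.
move=> i; split; first by move=> x; exact: Ck_derivable cf.
exact/IH/Ck_derive.
Qed.

Lemma Ck_cst k (c : R) : Ck k (cst c : R3 R -> R).
Proof.
elim: k c => [|k IH] c; first by move=> x; exact: cvg_cst.
split; first by move=> x; exact: cvg_cst.
move=> i; split; first by move=> x; exact: derivable_cst.
under eq_fun do rewrite derive_cst; exact: IH.
Qed.

Lemma CkD k f g : Ck k f -> Ck k g -> Ck k (fun x => f x + g x).
Proof.
elim: k f g => [|k IH] f g cf cg.
  by move=> x; apply: cvgD; [exact: cf|exact: cg].
split.
  by move=> x; apply: cvgD; [exact: Ck_continuous cf _|exact: Ck_continuous cg _].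
move=> i; split.
  move=> x; apply: derivableD; [exact: Ck_derivable cf|exact: Ck_derivable cg].
have -> : (fun x => 'D_(axis_vec R i) (fun x => f x + g x) x) =
    (fun x => 'D_(axis_vec R i) f x + 'D_(axis_vec R i) g x).
  apply/funext => x.
  by apply: deriveD; [exact: Ck_derivable cf|exact: Ck_derivable cg].
by apply: IH; exact: Ck_derive.
Qed.

Lemma CkM k f g : Ck k f -> Ck k g -> Ck k (fun x => f x * g x).
Proof.
elim: k f g => [|k IH] f g cf cg.
  by move=> x; apply: cvgM; [exact: cf|exact: cg].
split.
  by move=> x; apply: cvgM; [exact: Ck_continuous cf _|exact: Ck_continuous cg _].
move=> i; split.
  move=> x; apply: derivableM; [exact: Ck_derivable cf|exact: Ck_derivable cg].
have -> : (fun x => 'D_(axis_vec R i) (fun x => f x * g x) x) =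
    (fun x => f x * 'D_(axis_vec R i) g x + g x * 'D_(axis_vec R i) f x).
  apply/funext => x.
  by apply: deriveM; [exact: Ck_derivable cf|exact: Ck_derivable cg].
by apply: CkD; apply: IH; (try exact: CkW); exact: Ck_derive.
Qed.

(** The outer function comes with the whole sequence of its derivatives: a partial derivative of
    [T n \o h] is [T n.+1 \o h] times one of [h], so the induction must hold for all [n] at once. *)
Lemma Ck_comp (T : nat -> R -> R) k n h :
  (forall m t, is_derive t 1 (T m) (T m.+1 t)) -> Ck k h -> Ck k (T n \o h).
Proof.
move=> dT; elim: k n h => [|k IH] n h ch.
  move=> x; apply: continuous_comp; first exact: ch.
  apply: differentiable_continuous; apply/derivable1_diffP.
  by have [] := dT n (h x).
have ch' := CkW ch.
have cT : Ck k (T n \o h) by exact: IH.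
have dTh x i := is_derive_comp1 (dT n) (@Ck_derivable _ _ x i ch).
split; first exact: Ck_continuous cT.
move=> i; split; first by move=> x; have [] := dTh x i.
have -> : (fun x => 'D_(axis_vec R i) (T n \o h) x) =
    (fun x => (T n.+1 \o h) x * 'D_(axis_vec R i) h x).
  by apply/funext => x; have [_ ->] := dTh x i.
by apply: CkM; [exact: IH|exact: Ck_derive].
Qed.

Lemma is_derive_affine f x v (c : R) :
  (forall t, f (t *: v + x) = t * c + f x) -> is_derive x v f c.
Proof.
move=> fE.
have d : is_derive (0 : R) 1 (fun t : R => f (t *: v + x)) c.
  under eq_fun do rewrite fE.
  have d0 : is_derive (0 : R) 1 ((fun t => t * c) \+ cst (f x)) c.
    by apply: is_derive_eq; rewrite addr0 scaler0 add0r [LHS]mulr1.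
  exact: d0.
have dd : derivable f x v by apply/derivable1P; have [] := d.
apply: DeriveDef => //.
by have [_ <-] := is_derive_line dd; have [_ <-] := d.
Qed.

Lemma pt_coordD (x y : R3 R) i : pt_coord (x + y) i = pt_coord x i + pt_coord y i.
Proof. by rewrite /pt_coord; case: ifP => // _; case: ifP. Qed.

Lemma pt_coordZ (t : R) (x : R3 R) i : pt_coord (t *: x) i = t * pt_coord x i.
Proof. by rewrite /pt_coord; case: ifP => // _; case: ifP. Qed.

Lemma pt_coord_axis i j : pt_coord (axis_vec R i) j = (i == j)%:R.
Proof.
case: i => -[|[|[|n]]] hi; case: j => -[|[|[|m]]] hj //.
Qed.

Lemma continuous_pt_coord i : continuous (fun x : R3 R => pt_coord x i).
Proof.
move=> x; rewrite /pt_coord; case: (i == 0); last case: (i == 1).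
- by apply: (@continuous_comp _ _ _ fst fst); exact: cvg_fst.
- by apply: (@continuous_comp _ _ _ fst snd); [exact: cvg_fst|exact: cvg_snd].
- exact: cvg_snd.
Qed.

Lemma Ck_coord k i : Ck k (fun x : R3 R => pt_coord x i).
Proof.
have dl j x : is_derive x (axis_vec R j) (fun x : R3 R => pt_coord x i) (j == i)%:R.
  by apply: is_derive_affine => t; rewrite pt_coordD pt_coordZ pt_coord_axis.
case: k => [|k]; first exact: continuous_pt_coord.
split; first exact: continuous_pt_coord.
move=> j; split; first by move=> x; have [] := dl j x.
have -> : (fun x => 'D_(axis_vec R j) (fun x : R3 R => pt_coord x i) x) =
    cst (j == i)%:R.
  by apply/funext => x; have [_ ->] := dl j x.
exact: Ck_cst.
Qed.

End SmoothCalculus.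

(** * A smooth function vanishing on a half-line *)

Section FlatFunction.
Variable R : realType.
Implicit Types (p : {poly R}) (t y : R).

(* For [p = 1] this is the classical smooth function [exp (- 1 / t)] for
   [0 < t], extended by 0; each derivative is again of this shape. *)
Definition flat p t : R := if 0 < t then p.[t^-1] * expR (- t^-1) else 0.

(** The product rule for [p(1/t) exp(- 1/t)], with the common factor [t^-2] written as ['X^2] in the
    variable [1/t]. *)
Definition flat_deriv p : {poly R} := 'X^2 * (p - p^`()).

(** Monomial by monomial, [y^n / n! <= exp y] for nonnegative [y]. *)
Lemma expR_dominates_poly p : exists2 C, 0 <= C & forall y, 0 <= y -> `|p.[y]| <= C * expR y.
Proof.
exists (\sum_(i < size p) `|p`_i| * (i`!)%:R); first by apply: sumr_ge0 => i _; exact: mulr_ge0.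
move=> y y0; rewrite horner_coef mulr_suml; apply: le_trans (ler_norm_sum _ _ _) _.
apply: ler_sum => i _; rewrite normrM -mulrA ler_wpM2l// ger0_norm ?exprn_ge0//.
case: (val i) => [|n]; first by rewrite expr0 fact0 mul1r -expR0 ler_expR.
rewrite mulrC -ler_pdivrMr ?ltr0n ?fact_gt0//.
by apply: le_trans (expR_ge1Dxn n y0); rewrite lerDr.
Qed.

(** Domination by the exponential is applied to ['X^2 * p] at [1/t]; the factor [t^-2] turns into
    the bound by [t^2], which is what differentiability at 0 requires. *)
Lemma flat_quadratic p : exists2 C, 0 <= C & forall t, `|flat p t| <= C * t ^+ 2.
Proof.
have [C C0 hC] := expR_dominates_poly ('X^2 * p).
exists C => // t; rewrite /flat; case: ifPn => [t0|_]; last by rewrite normr0 mulr_ge0// sqr_ge0.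
have ti0 : 0 <= t^-1 by rewrite invr_ge0 ltW.
have := hC _ ti0; rewrite hornerM hornerXn normrM (ger0_norm (exprn_ge0 2 ti0)) => h.
rewrite normrM (ger0_norm (expR_ge0 _)) expRN.
rewrite ler_pdivrMr ?expR_gt0// mulrAC -ler_pdivrMr ?exprn_gt0//.
by rewrite mulrC -exprVn.
Qed.

Lemma is_derive_flat p t : is_derive t 1 (flat p) (flat (flat_deriv p) t).
Proof.
case: (ltgtP t 0) => [t0|t0|->].
- rewrite {2}/flat ltNge (ltW t0) /=.
  apply: (@near_eq_is_derive _ _ _ (cst 0)).
    near=> s; rewrite /flat ltNge ltW//.
    near: s; exact: lt_nbhsl.
- rewrite {2}/flat t0.
  apply: (@near_eq_is_derive R R R (fun s : R => p.[s^-1] * expR (- s^-1))).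
    near=> s; rewrite /flat ifT//.
    near: s; exact: (cvgr_gt t cvg_id).
  have dV : is_derive t 1 (fun s : R => s^-1) (- t ^- 2 *: 1).
    exact: (@is_deriveV _ id t 1 1 (lt0r_neq0 t0) (is_derive_id _ _)).
  have dP := @is_derive1_comp _ (horner p) _ t _ _ (is_derive_poly p t^-1) dV.
  have dE := @is_derive1_comp _ expR _ t _ _ (is_derive_expR (- t^-1)) (is_deriveN dV).
  have [D1 D2] := is_deriveM dP dE; apply: DeriveDef; [exact: D1|apply: (etrans D2)].
  rewrite /flat_deriv hornerM hornerXn hornerD hornerN /=.
  rewrite /GRing.scale /= exprVn; ring.
(* The quadratic bound makes the difference quotient at most [C * |h|]; [C + 1] replaces [C] so that
   one may divide by it. *)
- have L : h^-1 *: ((flat p \o shift 0) (h *: 1) - flat p 0) @[h --> 0^'] --> (0 : R).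
    have [C C0 hC] := flat_quadratic p.
    have C1 : 0 < C + 1 by rewrite ltr_wpDl.
    apply/cvgr0Pnorm_lt => e e0; near=> h.
    have h0 : h != 0 by near: h; exact: nbhs_dnbhs_neq.
    have -> : flat p 0 = 0 by rewrite /flat ltxx.
    rewrite /= addr0 subr0 [h%:A]mulr1 normrZ normfV ltr_pdivrMl ?normr_gt0//.
    apply: le_lt_trans (hC h) _; rewrite -real_normK ?num_real// expr2 mulrCA ltr_pM2l ?normr_gt0//.
    have : `|h| < e / (C + 1).
      near: h; apply: dnbhs0_lt; exact: divr_gt0.
    rewrite ltr_pdivlMr//; apply: le_lt_trans; rewrite mulrC ler_wpM2l// lerDl.
    exact: ler01.
  have -> : flat (flat_deriv p) 0 = 0 by rewrite /flat ltxx.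
  by apply: DeriveDef; [apply/cvg_ex; exists 0|exact/cvg_lim].
Unshelve. all: by end_near. Qed.

End FlatFunction.

Section Cutoff.
Variable R : realType.
Implicit Types (H : 'I_3 -> R3 R -> R) (x : R3 R).

Lemma Ck_prod k (s : seq 'I_3) H :
  (forall i, Ck k (H i)) -> Ck k (fun x => \prod_(i <- s) H i x).
Proof.
move=> cH; elim: s => [|i s IH].
  by under eq_fun do rewrite big_nil; exact: Ck_cst.
by under eq_fun do rewrite big_cons; exact: CkM.
Qed.

Lemma Ck_flat k p (h : R3 R -> R) : Ck k h -> Ck k (flat p \o h).
Proof.
move=> ch; apply: (@Ck_comp _ (fun m => flat (iter m (@flat_deriv R) p)) _ 0%N) => //.
by move=> m t; rewrite iterS; exact: is_derive_flat.
Qed.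

Lemma flat1_ge0_le1 (t : R) : 0 <= flat 1 t <= 1.
Proof.
rewrite /flat; case: ifP => [t0|]; last by rewrite lexx ler01.
by rewrite hornerC mul1r expR_ge0 expR_le1 oppr_le0 invr_ge0 ltW.
Qed.

Lemma flat1_eq0 (t : R) : (flat 1 t == 0) = (t <= 0).
Proof.
rewrite /flat; case: ifPn => [t0|]; last by rewrite -leNgt eqxx => ->.
by rewrite hornerC mul1r gt_eqF ?expR_gt0// leNgt t0.
Qed.

Lemma flat1_scale_cvg (t : R) : 0 < t -> flat 1 (n.+1%:R * t) @[n --> \oo] --> (1 : R).
Proof.
move=> t0.
have -> : (fun n => flat 1 (n.+1%:R * t)) = (fun n => expR (- (t^-1 * harmonic n))).
  apply/funext => n; rewrite /flat mulr_gt0//.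
  by rewrite hornerC mul1r invfM mulrC.
have -> : (1 : R) = expR (- (t^-1 * 0)) by rewrite mulr0 oppr0 expR0.
apply: (@cvg_comp _ _ _ (fun n => - (t^-1 * harmonic n)) expR); last exact: continuous_expR.
by apply: cvgN; apply: cvgMr; exact: cvg_harmonic.
Qed.

(** Dilating the argument by [n.+1] drives each factor to 1 where [H i] is positive and keeps it 0
    elsewhere: a smooth sequence bounded by 1 that tends pointwise to an indicator. *)
Definition cutoff H n x : R := \prod_(i < 3) flat 1 (n.+1%:R * H i x).

Lemma Ck_cutoff k H n : (forall i, Ck k (H i)) -> Ck k (cutoff H n).
Proof.
move=> cH; apply: Ck_prod => i.
by apply: Ck_flat; apply: CkM => //; exact: Ck_cst.
Qed.

Lemma cutoff_norm_le1 H n x : `|cutoff H n x| <= 1.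
Proof.
rewrite /cutoff; elim/big_ind: _ => [|a b a1 b1|i _]; first by rewrite normr1.
  by rewrite normrM mulr_ile1.
by have /andP[f0 f1] := flat1_ge0_le1 (n.+1%:R * H i x); rewrite ger0_norm.
Qed.

Lemma cutoff_eq0 H n x i : H i x <= 0 -> cutoff H n x = 0.
Proof.
move=> Hi; rewrite /cutoff (bigD1 i)//=; have /eqP -> : flat 1 (n.+1%:R * H i x) == 0.
  by rewrite flat1_eq0 pmulr_rle0 ?ltr0n.
by rewrite mul0r.
Qed.

Lemma cutoff_cvg H x :
  cutoff H n x @[n --> \oo] --> ([forall i, 0 < H i x]%:R : R).
Proof.
case: (boolP [forall i, 0 < H i x]) => [/forallP h|].
  rewrite /cutoff; elim: (index_enum _) => [|i s IH].
    by under eq_fun do rewrite big_nil; exact: cvg_cst.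
  under eq_fun do rewrite big_cons.
  have -> : true%:R = 1 * 1 :> R by rewrite mulr1.
  by apply: cvgM => //; exact: flat1_scale_cvg.
rewrite negb_forall => /existsP[i]; rewrite -leNgt => Hi.
by under eq_fun do rewrite (cutoff_eq0 _ Hi); exact: cvg_cst.
Qed.

End Cutoff.

(** * Boxes and square-integrable fields *)

Section Boxes.
Variable R : realType.
Implicit Types (a b : 'I_3 -> R) (x : R3 R) (U : set (R3 R)).

Definition obox a b : set (R3 R) := [set x | forall i, a i < pt_coord x i < b i].
Definition cbox a b : set (R3 R) := [set x | forall i, a i <= pt_coord x i <= b i].

Lemma forall_ord3 (P : 'I_3 -> Prop) : P 0 -> P 1 -> P 2%:R -> forall i, P i.
Proof.
move=> P0 P1 P2 -[[|[|[|n]]] hn] //.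
- by rewrite (_ : Ordinal hn = 0) //; exact: val_inj.
- by rewrite (_ : Ordinal hn = 1) //; exact: val_inj.
- by rewrite (_ : Ordinal hn = 2%:R) //; exact: val_inj.
Qed.

Lemma oboxE a b : obox a b =
  (`]a 0, b 0[ `*` `]a 1, b 1[) `*` `]a 2%:R, b 2%:R[ :> set (R * R * R).
Proof.
apply/seteqP; split => [x h|x [[/= h0 h1] h2]].
  by split; [split|]; rewrite /= in_itv/=; [exact: h 0|exact: h 1|exact: h 2%:R].
rewrite !in_itv/= in h0 h1 h2.
exact: (@forall_ord3 (fun i => a i < pt_coord x i < b i)).
Qed.

Lemma cboxE a b : cbox a b =
  (`[a 0, b 0] `*` `[a 1, b 1]) `*` `[a 2%:R, b 2%:R] :> set (R * R * R).
Proof.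
apply/seteqP; split => [x h|x [[/= h0 h1] h2]].
  by split; [split|]; rewrite /= in_itv/=; [exact: h 0|exact: h 1|exact: h 2%:R].
rewrite !in_itv/= in h0 h1 h2.
exact: (@forall_ord3 (fun i => a i <= pt_coord x i <= b i)).
Qed.

Lemma measurable_obox a b : measurable (obox a b : set (R3m R)).
Proof. by rewrite oboxE; apply: measurableX; [apply: measurableX|]; exact: measurable_itv. Qed.

Lemma measurable_cbox a b : measurable (cbox a b : set (R3m R)).
Proof. by rewrite cboxE; apply: measurableX; [apply: measurableX|]; exact: measurable_itv. Qed.

Lemma compact_cbox a b : compact (cbox a b).
Proof.
rewrite cboxE; apply: compact_setX; last exact: segment_compact.
by apply: compact_setX; exact: segment_compact.
Qed.

Lemma lebesgue3X (A B C : set (measurableTypeR R)) :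
  measurable A -> measurable B -> measurable C ->
  lebesgue3 R ((A `*` B) `*` C) =
  (@lebesgue_measure R A * @lebesgue_measure R B * @lebesgue_measure R C)%E.
Proof.
move=> mA mB mC; transitivity
  ((@lebesgue_measure R \x @lebesgue_measure R)%E (A `*` B) * @lebesgue_measure R C)%E.
  by apply: product_measure1E => //; exact: measurableX.
by congr (_ * _)%E; exact: product_measure1E.
Qed.

Lemma lebesgue3_cbox_fin a b : (lebesgue3 R (cbox a b) < +oo)%E.
Proof.
rewrite cboxE lebesgue3X; [|exact: measurable_itv..].
by rewrite !lebesgue_measure_itv; do 3 case: ifP => _ //=; rewrite ?mule0 ?mul0e ?ltry.
Qed.

Lemma obox_sub_cbox a b : obox a b `<=` cbox a b.
Proof. by move=> x h i; have /andP[/ltW -> /ltW ->] := h i. Qed.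

Lemma open_ball_coord U x : open U -> U x ->
  exists2 e, 0 < e & forall y, (forall i, `|pt_coord y i - pt_coord x i| < e) -> U y.
Proof.
move=> oU Ux; have /nbhs_ballP[e /= e0 he] := open_nbhs_nbhs (conj oU Ux).
exists e => // y hy; apply: he; split; [split|]; rewrite /ball/= distrC.
- exact: hy 0.
- exact: hy 1.
- exact: hy 2%:R.
Qed.

Definition rat_lo (q : {ffun 'I_3 -> rat * rat}) i : R := ratr (q i).1.
Definition rat_hi (q : {ffun 'I_3 -> rat * rat}) i : R := ratr (q i).2.

(** Rational endpoints leave countably many boxes. The closed box must fit in [U], since it will
    contain the support of a test field, while the open one must still contain [x]. *)
Lemma open_rat_box U x : open U -> U x ->
  exists2 q, cbox (rat_lo q) (rat_hi q) `<=` U & obox (rat_lo q) (rat_hi q) x.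
Proof.
move=> oU Ux; have [e e0 he] := open_ball_coord oU Ux.
have hq i : exists p : rat * rat,
    (pt_coord x i - e < ratr p.1 < pt_coord x i) /\
    (pt_coord x i < ratr p.2 < pt_coord x i + e).
  have l1 : pt_coord x i - e < pt_coord x i by rewrite ltrBlDr ltrDl.
  have l2 : pt_coord x i < pt_coord x i + e by rewrite ltrDl.
  have [p1] := rat_in_itvoo l1; have [p2] := rat_in_itvoo l2.
  by rewrite !in_itv/= => h2 h1; exists (p1, p2).
have [q Hq] := choice hq.
have qE : forall i, [ffun i => q i] i = q i by move=> i; rewrite ffunE.
exists [ffun i => q i] => [y hy|i].
  apply: he => i; have := hy i; rewrite /rat_lo /rat_hi qE.
  have [/andP[h1 h2] /andP[h3 h4]] := Hq i => /andP[h5 h6].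
  by rewrite ltr_norml; apply/andP; split; lra.
rewrite /rat_lo /rat_hi qE.
by have [/andP[h1 h2] /andP[h3 h4]] := Hq i; rewrite h2 h3.
Qed.

Lemma open_bigcup_box U : open U ->
  U = \bigcup_(q in [set q | cbox (rat_lo q) (rat_hi q) `<=` U])
        obox (rat_lo q) (rat_hi q).
Proof.
move=> oU; apply/seteqP; split => [x Ux|x [q /= qU /obox_sub_cbox]]; last exact: qU.
by have [q q1 q2] := open_rat_box oU Ux; exists q.
Qed.

Lemma open_measurable3 U : open U -> measurable (U : set (R3m R)).
Proof.
move=> oU; rewrite (open_bigcup_box oU) bigcup_mkcond.
apply: countable_bigcupT_measurable => [|q]; first exact: countableP.
by case: ifP => _; [exact: measurable_obox|exact: measurable0].
Qed.

Lemma continuous_measurable3 (D : set (R3m R)) (f : R3 R -> R) :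
  continuous f -> measurable_fun D (f : R3m R -> R).
Proof.
move=> cf; apply: measurable_funTS.
move=> mT; apply: (measurability _ (RGenOpens.measurableE R)) => //.
move=> _ [_ [a [b ->] <-]]; rewrite setTI; apply: open_measurable3.
by apply: open_comp => [x _|]; [exact: cf|exact: interval_open].
Qed.

Lemma continuous_bounded_cbox a b (f : R3 R -> R) : continuous f ->
  exists C : R, forall x, cbox a b x -> `|f x| <= C.
Proof.
move=> cf.
have cpt : compact (f @` cbox a b).
  by apply: continuous_compact (@compact_cbox a b); exact: continuous_subspaceT.
have [M [_ hM]] := compact_bounded cpt.
by exists (M + 1) => x hx; apply: (hM (M + 1)); [rewrite ltrDl|exists x].
Qed.

End Boxes.

Section L2Fields.
Variables (R : realType) (Om : region R).
Hypothesis wf : wf_region Om.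
Implicit Types (F G : vfield R) (f g : R3 R -> R).

Lemma pt_coord_le_norm (x : R3 R) i : `|pt_coord x i| <= `|x|.
Proof.
rewrite /pt_coord !prod_normE !le_max.
by case: (i == 0); last case: (i == 1); rewrite lexx ?orbT.
Qed.

Lemma carrier_cbox : exists2 M : R, 0 < M &
  carrier Om `<=` cbox (fun=> - M) (fun=> M).
Proof.
case: Om wf => [_|U [_ _ _ [M [_ hM]]]] /=; first by exists pi => //; exact: pi_gt0.
exists (`|M| + 1) => [|x Ux i]; first by rewrite ltr_wpDl.
rewrite -ler_norml; apply: le_trans (pt_coord_le_norm x i) _.
by apply: hM => //; rewrite ltr_pwDr// ler_norm.
Qed.

Lemma measurable_carrier : measurable (carrier Om : set (R3m R)).
Proof.
case: Om wf => [_|U [oU _ _ _]]; last exact: open_measurable3.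
exact: (@measurable_cbox R (fun=> - pi) (fun=> pi)).
Qed.

Let mD := measurable_carrier.

Lemma carrier_fin : (lebesgue3 R (carrier Om) < +oo)%E.
Proof.
have [M _ hM] := carrier_cbox.
apply: le_lt_trans (lebesgue3_cbox_fin (fun=> - M) (fun=> M)).
by apply: le_measure; rewrite ?inE//; exact: measurable_cbox.
Qed.

Lemma integrable_continuous f : continuous f ->
  (lebesgue3 R).-integrable (carrier Om) (EFin \o f).
Proof.
move=> cf; apply: measurable_bounded_integrable => //.
- exact: carrier_fin.
- exact: continuous_measurable3.
have [M _ hM] := carrier_cbox.
have [C hC] := continuous_bounded_cbox (fun=> - M) (fun=> M) cf.
exists C; split; first exact: num_real.
by move=> y Cy x Dx; apply: le_trans (ltW Cy); exact/hC/hM.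
Qed.

Lemma L2_continuous F : (forall i, continuous (F i)) -> L2 Om F.
Proof.
move=> cF i; split; first exact: continuous_measurable3.
apply: integrable_continuous => x.
by apply: (@continuous_comp _ _ _ (F i) (fun y => y ^+ 2)); [exact: cF|exact: exprn_continuous].
Qed.

(** The product is dominated by [f^2 + g^2]. *)
Lemma integrable_mul f g :
  measurable_fun (carrier Om) (f : R3m R -> R) ->
  measurable_fun (carrier Om) (g : R3m R -> R) ->
  (lebesgue3 R).-integrable (carrier Om) (fun x => (f x ^+ 2)%:E) ->
  (lebesgue3 R).-integrable (carrier Om) (fun x => (g x ^+ 2)%:E) ->
  (lebesgue3 R).-integrable (carrier Om) (fun x => (f x * g x)%:E).
Proof.
move=> mf mg f2 g2; have := integrableD mD f2 g2.
apply: le_integrable => // [|x _].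
  by apply/measurable_EFinP; exact: measurable_funM.
rewrite /= lee_fin normrM [leRHS]ger0_norm ?addr_ge0 ?sqr_ge0//.
rewrite -(real_normK (num_real (f x))) -(real_normK (num_real (g x))).
have := sqr_ge0 (`|f x| - `|g x|); have := sqr_ge0 `|f x|; have := sqr_ge0 `|g x|.
by nra.
Qed.

Definition vscale (c : R) F : vfield R := fun i x => c * F i x.

Lemma L2D F G : L2 Om F -> L2 Om G -> L2 Om (vadd F G).
Proof.
move=> LF LG i; have [mF F2] := LF i; have [mG G2] := LG i; split.
  exact: measurable_funD.
have FG := integrable_mul mF mG F2 G2.
have := integrableD mD (integrableD mD F2 G2) (integrableD mD FG FG).
apply: eq_integrable => // x _ /=; rewrite /vadd -!EFinD; congr EFin; ring.
Qed.

Lemma L2Z c F : L2 Om F -> L2 Om (vscale c F).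
Proof.
move=> LF i; have [mF F2] := LF i; split; first exact: measurable_funM.
have := integrableZl mD (c ^+ 2) F2.
by apply: eq_integrable => // x _ /=; rewrite /vscale exprMn EFinM.
Qed.

Lemma integrable_dot F G : L2 Om F -> L2 Om G ->
  (lebesgue3 R).-integrable (carrier Om) (EFin \o dot F G).
Proof.
move=> LF LG.
have FG i : (lebesgue3 R).-integrable (carrier Om) (fun x => (F i x * G i x)%:E).
  by have [mF F2] := LF i; have [mG G2] := LG i; exact: integrable_mul.
have := integrableD mD (FG ord0) (integrableD mD (FG (lift ord0 ord0)) (FG (lift ord0 (lift ord0 ord0)))).
by apply: eq_integrable => // x _ /=; rewrite /dot !big_ord_recl big_ord0 addr0.
Qed.

Lemma innerC F G : inner Om F G = inner Om G F.
Proof.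
by apply: eq_Rintegral => x _; rewrite /dot; apply: eq_bigr => i _; rewrite mulrC.
Qed.

Lemma innerDl F F' G : L2 Om F -> L2 Om F' -> L2 Om G ->
  inner Om (vadd F F') G = inner Om F G + inner Om F' G.
Proof.
move=> LF LF' LG; rewrite /inner -RintegralD//; [|exact: integrable_dot..].
apply: eq_Rintegral => x _; rewrite /dot -big_split; apply: eq_bigr => i _.
by rewrite mulrDl.
Qed.

Lemma innerDr F G G' : L2 Om F -> L2 Om G -> L2 Om G' ->
  inner Om F (vadd G G') = inner Om F G + inner Om F G'.
Proof. by move=> ? ? ?; rewrite innerC innerDl// innerC (innerC G'). Qed.

Lemma innerZl c F G : L2 Om F -> L2 Om G ->
  inner Om (vscale c F) G = c * inner Om F G.
Proof.
move=> LF LG; rewrite /inner -RintegralZl//; last exact: integrable_dot.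
apply: eq_Rintegral => x _; rewrite /dot mulr_sumr; apply: eq_bigr => i _.
by rewrite mulrA.
Qed.

Lemma innerZr c F G : L2 Om F -> L2 Om G ->
  inner Om F (vscale c G) = c * inner Om F G.
Proof. by move=> ? ?; rewrite innerC innerZl// innerC. Qed.

Lemma energyE F G : L2 Om F -> L2 Om G ->
  energy Om F G = inner Om F F + inner Om G G.
Proof. by move=> LF LG; rewrite /inner -RintegralD//; exact: integrable_dot. Qed.

End L2Fields.

(** * Integration by parts *)

Section BoxDivergence.
Variable R : realType.
Implicit Types (f : R3 R -> R) (p x : R3 R).

Lemma is_derive_line_at f i p (t : R) : derivable f (t *: axis_vec R i + p) (axis_vec R i) ->
  is_derive t 1 (fun s : R => f (s *: axis_vec R i + p)) ('D_(axis_vec R i) f (t *: axis_vec R i + p)).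
Proof.
move=> /is_derive_line d.
have ds : is_derive t 1 (fun s : R => s - t) (1 : R).
  have d0 : is_derive t 1 (id \- cst t) (1 - 0 : R) by exact: is_deriveB.
  by rewrite -[X in is_derive _ _ _ X]subr0.
set g := fun s : R => f (s *: axis_vec R i + (t *: axis_vec R i + p)) in d.
have dg : is_derive (t - t) 1 g ('D_(axis_vec R i) f (t *: axis_vec R i + p)).
  by rewrite subrr.
have := @is_derive1_comp R g (fun s => s - t) t _ _ dg ds; rewrite mulr1.
suff -> : g \o (fun s => s - t) = fun s : R => f (s *: axis_vec R i + p) by [].
by apply/funext => s /=; rewrite /g addrA -scalerDl subrK.
Qed.

Lemma continuous_line i p : continuous (fun t : R => t *: axis_vec R i + p).
Proof. by move=> t; apply: cvgD; [exact: scalel_continuous|exact: cvg_cst]. Qed.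

(** The fundamental theorem of calculus along an axis; the two endpoint values cancel. *)
Lemma line_integral_eq0 f i p (M : R) : 0 < M ->
  continuous f -> (forall x, derivable f x (axis_vec R i)) ->
  continuous (fun x => 'D_(axis_vec R i) f x) ->
  f (M *: axis_vec R i + p) = f (- M *: axis_vec R i + p) ->
  (\int[@lebesgue_measure R]_(t in `[(- M)%R, M]) ('D_(axis_vec R i) f (t *: axis_vec R i + p)%R)%:E = 0)%E.
Proof.
move=> M0 cf df cDf per.
have ct (g : R3 R -> R) : continuous g -> continuous (fun t : R => g (t *: axis_vec R i + p)).
  move=> cg t.
  apply: (@continuous_comp _ _ _ (fun t : R => t *: axis_vec R i + p) g).
    exact: continuous_line.
  exact: cg.
have d t := is_derive_line_at (df (t *: axis_vec R i + p)).
rewrite (@continuous_FTC2 _ _ (fun t : R => f (t *: axis_vec R i + p))).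
- by rewrite per -EFinB subrr.
- by rewrite gtrN.
- exact: (continuous_subspaceT (ct _ cDf)).
- split.
  + by move=> t _; have [] := d t.
  + by apply: cvg_at_right_filter; exact: (ct _ cf).
  + by apply: cvg_at_left_filter; exact: (ct _ cf).
- by move=> t _; rewrite derive1E; have [_ ->] := d t.
Qed.

End BoxDivergence.

Section PlaneMeasure.
Variable R : realType.

(* A name for the plane Lebesgue measure: the library declares the
   sigma-finite structure of products only for products of subprobabilities. *)
Definition lebesgue2 : set (measurableTypeR R * measurableTypeR R)%type -> \bar R :=
  (@lebesgue_measure R \x @lebesgue_measure R)%E.

HB.instance Definition _ := Measure.copy lebesgue2
  (@lebesgue_measure R \x @lebesgue_measure R)%E.

Lemma lebesgue2X (A B : set (measurableTypeR R)) : measurable A -> measurable B ->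
  lebesgue2 (A `*` B) = (@lebesgue_measure R A * @lebesgue_measure R B)%E.
Proof. exact: product_measure1E. Qed.

Lemma lebesgue2_square_fin (M : R) : (lebesgue2 (`[(- M)%R, M] `*` `[(- M)%R, M]) < +oo)%E.
Proof.
rewrite lebesgue2X; [|exact: measurable_itv..].
by rewrite !lebesgue_measure_itv; case: ifP => _ //=; rewrite ?mule0 ?ltry.
Qed.

Let lebesgue2_sigma_finite : sigma_finite setT lebesgue2.
Proof.
exists (fun n => `[- n%:R, n%:R] `*` `[- n%:R, n%:R]).
  apply/seteqP; split => // -[x y] _; exists (Num.bound (`|x| + `|y|)) => //=.
  have := archi_boundP (addr_ge0 (normr_ge0 x) (normr_ge0 y)) => hn.
  by split; rewrite /= in_itv /= -ler_norml; apply: ltW; apply: le_lt_trans hn;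
    rewrite ?lerDl ?lerDr.
move=> n; split; last exact: lebesgue2_square_fin.
by apply: measurableX; exact: measurable_itv.
Qed.

HB.instance Definition _ := Measure_isSigmaFinite.Build _ _ _ lebesgue2
  lebesgue2_sigma_finite.

(** This Fubini identity and the next three let any of the three coordinates become the innermost
    variable of integration. *)
Lemma integral_lebesgue3_snd (F : R3m R -> \bar R) :
  (lebesgue3 R).-integrable setT F ->
  (\int[lebesgue3 R]_x F x =
   \int[lebesgue2]_xy \int[@lebesgue_measure R]_z F (xy, z))%E.
Proof. by move=> iF; rewrite (@integral12_prod_meas1 _ _ _ _ _ lebesgue2 (@lebesgue_measure R) F iF). Qed.

Lemma integral_lebesgue3_fst (F : R3m R -> \bar R) :
  (lebesgue3 R).-integrable setT F ->
  (\int[lebesgue3 R]_x F x =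
   \int[@lebesgue_measure R]_z \int[lebesgue2]_xy F (xy, z))%E.
Proof. by move=> iF; rewrite (@integral21_prod_meas1 _ _ _ _ _ lebesgue2 (@lebesgue_measure R) F iF). Qed.

Lemma integral_lebesgue2_snd (F : measurableTypeR R * measurableTypeR R -> \bar R) :
  lebesgue2.-integrable setT F ->
  (\int[lebesgue2]_x F x =
   \int[@lebesgue_measure R]_x \int[@lebesgue_measure R]_y F (x, y))%E.
Proof.
move=> iF.
by rewrite (@integral12_prod_meas1 _ _ _ _ _ (@lebesgue_measure R) (@lebesgue_measure R) F iF).
Qed.

Lemma integral_lebesgue2_fst (F : measurableTypeR R * measurableTypeR R -> \bar R) :
  lebesgue2.-integrable setT F ->
  (\int[lebesgue2]_x F x =
   \int[@lebesgue_measure R]_y \int[@lebesgue_measure R]_x F (x, y))%E.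
Proof.
move=> iF.
by rewrite (@integral21_prod_meas1 _ _ _ _ _ (@lebesgue_measure R) (@lebesgue_measure R) F iF).
Qed.

End PlaneMeasure.

(** * Partial derivatives integrate to zero over a cube when opposite faces agree *)

Section BoxDivergence2.
Variables (R : realType) (M : R) (f : R3 R -> R) (i : 'I_3).
Hypotheses (M0 : 0 < M) (cf : continuous f)
  (df : forall x, derivable f x (axis_vec R i))
  (cDf : continuous (fun x => 'D_(axis_vec R i) f x))
  (per : forall p, pt_coord p i = 0 ->
     f (M *: axis_vec R i + p) = f (- M *: axis_vec R i + p)).

Local Notation K := (cbox (fun=> - M) (fun=> M) : set (R3m R)).
Local Notation h := (fun x => 'D_(axis_vec R i) f x).

Let F : R3m R -> \bar R := (EFin \o h) \_ K.

Let integrable_h : (lebesgue3 R).-integrable K (EFin \o h).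
Proof.
apply: measurable_bounded_integrable.
- exact: measurable_cbox.
- exact: lebesgue3_cbox_fin.
- exact: continuous_measurable3.
have [C hC] := continuous_bounded_cbox (fun=> - M) (fun=> M) cDf.
exists C; split; first exact: num_real.
by move=> y Cy x Dx; apply: le_trans (ltW Cy); exact: hC.
Qed.

Let integrable_F : (lebesgue3 R).-integrable setT F.
Proof. exact: (integrable_mkcond _ (@measurable_cbox R _ _)).1 integrable_h. Qed.

Let pt_coord_line p (t : R) j : pt_coord p i = 0 ->
  pt_coord (t *: axis_vec R i + p) j = if j == i then t else pt_coord p j.
Proof.
move=> p0; rewrite pt_coordD pt_coordZ pt_coord_axis eq_sym.
by case: eqP => [->|_]; rewrite ?p0 ?mulr1 ?addr0 ?mulr0 ?add0r.
Qed.

(** A line parallel to the axis either meets the cube in a full segment, where the one-dimensional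
    result applies, or misses it, where the extension by 0 vanishes. *)
Let integral_line p : pt_coord p i = 0 ->
  (\int[@lebesgue_measure R]_t F (t *: axis_vec R i + p)%R = 0)%E.
Proof.
move=> p0; case: (pselect (forall j, j != i -> - M <= pt_coord p j <= M)) => [hp|hp].
  rewrite -(line_integral_eq0 M0 cf df cDf (per p0)) [RHS]integral_mkcond.
  apply: eq_integral => t _; rewrite /F !patchE; congr (if _ then _ else _).
  apply/idP/idP; rewrite !inE /= in_itv /=.
    by move=> /(_ i); rewrite pt_coord_line// eqxx.
  by move=> tM j; rewrite pt_coord_line//; case: ifPn => // /hp.
apply: integral0_eq => t _; rewrite /F patchE memNset// => hK; apply: hp => j ji.
by have := hK j; rewrite pt_coord_line// (negbTE ji).
Qed.

Let line_decomp0 (x y z : R) : (x, y, z) = x *: axis_vec R 0 + (0, y, z).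
Proof.
by apply: injective_projections; [apply: injective_projections|];
  rewrite /= /GRing.scale /= ?mulr1 ?mulr0 ?addr0 ?add0r.
Qed.

Let line_decomp1 (x y z : R) : (x, y, z) = y *: axis_vec R 1 + (x, 0, z).
Proof.
by apply: injective_projections; [apply: injective_projections|];
  rewrite /= /GRing.scale /= ?mulr1 ?mulr0 ?addr0 ?add0r.
Qed.

Let line_decomp2 (x y z : R) : (x, y, z) = z *: axis_vec R 2%:R + (x, y, 0).
Proof.
by apply: injective_projections; [apply: injective_projections|];
  rewrite /= /GRing.scale /= ?mulr1 ?mulr0 ?addr0 ?add0r.
Qed.

Let integral_F : (\int[lebesgue3 R]_x F x = 0)%E.
Proof.
have hi : i = 0 \/ (i = 1 \/ i = 2%:R).
  by move: (i); apply: forall_ord3; [left|right; left|right; right].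
have [i2|i01] : i = 2%:R \/ (i = 0 \/ i = 1) by tauto.
  rewrite (integral_lebesgue3_snd integrable_F).
  apply: integral0_eq => -[x y] _ /=.
  under eq_integral do rewrite line_decomp2 -i2.
  by apply: integral_line; rewrite i2.
rewrite (integral_lebesgue3_fst integrable_F).
apply: integral0_eq => z _ /=.
(* Integrability in space would give integrable slices for almost every [z] only; boundedness on the
   cube gives it for every [z]. *)
have Fz : (@lebesgue2 R).-integrable setT (fun xy => F (xy, z)).
  have -> : (fun xy => F (xy, z)) =
      (EFin \o (fun xy : measurableTypeR R * measurableTypeR R =>
        (h \_ K) (xy, z))) \_ (`[- M, M] `*` `[- M, M]).
    apply/funext => xy; rewrite /F !patchE /= !patchE cboxE.
    case: ifPn => [|_]; last by case: ifP.
    by rewrite inE => -[[? ?] ?] /=; rewrite mem_set.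
  have mAB : measurable (`[- M, M] `*` `[- M, M] : set (measurableTypeR R * measurableTypeR R)).
    by apply: measurableX; exact: measurable_itv.
  apply: (integrable_mkcond _ mAB).1; apply: measurable_bounded_integrable => //.
  - exact: lebesgue2_square_fin.
  - apply: measurable_funTS.
    apply: (measurableT_comp (f := h \_ K)); last exact: pair2_measurable.
    apply: (measurable_restrictT _ _).1; first exact: measurable_cbox.
    exact: continuous_measurable3.
  have [C hC] := continuous_bounded_cbox (fun=> - M) (fun=> M) cDf.
  exists `|C|; split; first exact: num_real.
  move=> y Cy x _; apply: le_trans (ltW Cy); rewrite patchE.
  case: ifPn => [|_]; last by rewrite normr0.
  by rewrite inE => /hC; move/le_trans; apply; exact: ler_norm.
case: i01 => [i0|i1].
  rewrite (integral_lebesgue2_fst Fz).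
  apply: integral0_eq => y _ /=.
  under eq_integral do rewrite line_decomp0 -i0.
  by apply: integral_line; rewrite i0.
rewrite (integral_lebesgue2_snd Fz).
apply: integral0_eq => x _ /=.
under eq_integral do rewrite line_decomp1 -i1.
by apply: integral_line; rewrite i1.
Qed.

Lemma box_divergence : \int[lebesgue3 R]_(x in K) h x = 0.
Proof. by rewrite /Rintegral integral_mkcond integral_F. Qed.

End BoxDivergence2.

(** * Integration by parts for the curl *)

Section CurlByParts.
Variables (R : realType) (Om : region R).
Hypothesis wf : wf_region Om.
Implicit Types (F phi : vfield R) (f g : R3 R -> R).

Lemma test_field_smooth F : test_field Om F -> smooth F.
Proof. by case: Om => [|U] []. Qed.

Lemma test_field_bc_smooth F : test_field_bc Om F -> smooth F.
Proof. by case: Om => [[]|]. Qed.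

Lemma smooth_continuous F i : smooth F -> continuous (F i).
Proof. by move=> sF; exact: sF 0%N i. Qed.

Lemma smooth_derivable F i j x : smooth F -> derivable (F i) x (axis_vec R j).
Proof. by move=> sF; exact: (Ck_derivable (sF 1%N i)). Qed.

Lemma smooth_derive_continuous F i j : smooth F ->
  continuous (fun x => 'D_(axis_vec R j) (F i) x).
Proof. by move=> sF; exact: (Ck_derive j (sF 1%N i)). Qed.

Lemma smooth_curl_continuous F i : smooth F -> continuous (curl F i).
Proof. by move=> sF x; apply: cvgB; exact: smooth_derive_continuous. Qed.

Lemma derive_eq0_off_closed (K : set (R3 R)) f x v : closed K ->
  (forall y, ~ K y -> f y = 0) -> ~ K x -> 'D_v f x = 0.
Proof.
move=> clK f0 nKx; rewrite -(derive_cst (0 : R) x v); apply: near_eq_derive.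
have : nbhs x (~` K) by apply: open_nbhs_nbhs; split => //; exact: closed_openC.
by apply: filterS => y; exact: f0.
Qed.

(* On a bounded domain [f] vanishes on the faces of a large cube; on the torus
   opposite faces contribute the same values. *)
Lemma Rintegral_derive_eq0 (f : R3 R -> R) j :
  (forall k, Ck k f) ->
  match Om with
  | Torus => forall x, f (x + (2 * pi) *: axis_vec R j) = f x
  | Domain U => exists2 K, compact K /\ K `<=` U & forall x, ~ K x -> f x = 0
  end ->
  \int[lebesgue3 R]_(x in carrier Om) 'D_(axis_vec R j) f x = 0.
Proof.
move=> sf; have [cf df] : continuous f /\ (forall x, derivable f x (axis_vec R j)).
  by split; [exact: (sf 0%N)|move=> x; exact: (Ck_derivable (sf 1%N))].
have cDf : continuous (fun x => 'D_(axis_vec R j) f x) by exact: (Ck_derive j (sf 1%N)).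
have := carrier_cbox wf.
case: Om => [_ per|U [M M0 hM] [K [cK KU] f0]].
  apply: (box_divergence (pi_gt0 R) cf df cDf) => p _.
  rewrite -[RHS]per addrAC -scalerDl; congr (f (_ *: _ + _)); ring.
(* The region lies in the cube of half-side [M], so the faces of the larger cube avoid the support
   of [f]. *)
have M1 : 0 < M + 1 by rewrite ltr_wpDl// ltW.
rewrite -(box_divergence M1 cf df cDf).
  rewrite Rintegral_mkcond [RHS]Rintegral_mkcond; apply: eq_Rintegral => x _.
  rewrite !patchE; case: (pselect (U x)) => [Ux|nUx].
    rewrite mem_set//= mem_set// => i; have /andP[h1 h2] := hM _ Ux i.
    by apply/andP; split; lra.
  rewrite memNset//= (@derive_eq0_off_closed K) ?if_same//.
    exact: (compact_closed (@norm_hausdorff _ _) cK).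
  by move=> Kx; exact/nUx/KU.
move=> p pj; rewrite !f0 // => /KU/hM/(_ j);
  rewrite pt_coordD pt_coordZ pt_coord_axis eqxx pj mulr1 addr0 => /andP[h1 h2]; lra.
Qed.

(** On a domain the compact support of [F] alone makes the product compactly supported, so [phi] may
    be nonzero on the boundary; on the torus the product is periodic. *)
Lemma test_field_by_parts F phi j k l : test_field Om F -> test_field_bc Om phi ->
  \int[lebesgue3 R]_(x in carrier Om)
    (F k x * 'D_(axis_vec R j) (phi l) x + phi l x * 'D_(axis_vec R j) (F k) x) = 0.
Proof.
move=> tF tphi; have sF := test_field_smooth tF; have sp := test_field_bc_smooth tphi.
have -> : (fun x => F k x * 'D_(axis_vec R j) (phi l) x +
    phi l x * 'D_(axis_vec R j) (F k) x) =
    (fun x => 'D_(axis_vec R j) (fun y => F k y * phi l y) x).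
  by apply/funext => x; rewrite -[RHS]/('D_(axis_vec R j) (F k * phi l) x) deriveM//;
    exact: smooth_derivable.
apply: Rintegral_derive_eq0; first by move=> m; exact: CkM.
move: tF tphi; case: Om => [[_ pF] [_ pp] x|U [_ [K [cK KU K0]]] _].
  by rewrite pF pp.
by exists K => // x nKx; rewrite K0 ?mul0r.
Qed.

Lemma sum_ord3 (G : 'I_3 -> R) : \sum_(i < 3) G i = G 0 + G 1 + G 2%:R.
Proof.
rewrite !big_ord_recl big_ord0 addr0 addrA.
by congr (G _ + G _ + G _); exact: val_inj.
Qed.

Lemma continuous_dot F phi : (forall i, continuous (F i)) ->
  (forall i, continuous (phi i)) -> continuous (dot F phi).
Proof.
move=> cF cp; have -> : dot F phi =
    fun x => F 0 x * phi 0 x + F 1 x * phi 1 x + F 2%:R x * phi 2%:R x.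
  by apply/funext => x; rewrite /dot sum_ord3.
by apply: (@CkD _ 0%N); [apply: (@CkD _ 0%N)|]; apply: (@CkM _ 0%N).
Qed.

Let RintegralB_eq0 (f g : R3 R -> R) : continuous f -> continuous g ->
  \int[lebesgue3 R]_(x in carrier Om) g x = 0 ->
  \int[lebesgue3 R]_(x in carrier Om) (f x - g x) = \int[lebesgue3 R]_(x in carrier Om) f x.
Proof.
move=> cf cg g0; rewrite RintegralB ?g0 ?subr0//.
- exact: measurable_carrier.
- exact: integrable_continuous.
- exact: integrable_continuous.
Qed.

(* [F . curl phi - curl F . phi] is the divergence of [phi x F], written here
   as a combination of partial derivatives of products [F k * phi l]. *)
Lemma is_curl_bc_test F : test_field Om F -> is_curl_bc Om F (curl F).
Proof.
move=> tF phi tp; have sF := test_field_smooth tF; have sp := test_field_bc_smooth tp.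
pose T j k l (x : R3 R) :=
  F k x * 'D_(axis_vec R j) (phi l) x + phi l x * 'D_(axis_vec R j) (F k) x.
have T0 j k l : \int[lebesgue3 R]_(x in carrier Om) T j k l x = 0.
  exact: test_field_by_parts.
have cT j k l : continuous (T j k l).
  by move=> x; apply: cvgD; apply: cvgM;
    do ?[exact: smooth_derive_continuous|exact: smooth_continuous].
have cB (f g : R3 R -> R) : continuous f -> continuous g -> continuous (fun x => f x - g x).
  by move=> cf cg x; apply: cvgB; [exact: cf|exact: cg].
have cS (f : R3 R -> R) j k l j' k' l' j'' k'' l'' : continuous f ->
    \int[lebesgue3 R]_(x in carrier Om) (f x - T j k l x - T j' k' l' x - T j'' k'' l'' x) =
    \int[lebesgue3 R]_(x in carrier Om) f x.
  move=> cf; have c1 := cB _ _ cf (cT j k l); have c2 := cB _ _ c1 (cT j' k' l').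
  rewrite (RintegralB_eq0 c2 (cT _ _ _) (T0 _ _ _)).
  by rewrite (RintegralB_eq0 c1 (cT _ _ _) (T0 _ _ _)) (RintegralB_eq0 cf (cT _ _ _) (T0 _ _ _)).
(* From each side are subtracted the three null integrals that contain its positively signed terms;
   the integrands then agree pointwise. *)
rewrite /inner -(cS _ 1 0 2%:R 2%:R 1 0 0 2%:R 1); last first.
  by apply: continuous_dot => i; [exact: smooth_continuous|exact: smooth_curl_continuous].
rewrite -[RHS](cS _ 2%:R 0 1 0 1 2%:R 1 2%:R 0); last first.
  by apply: continuous_dot => i; [exact: smooth_curl_continuous|exact: smooth_continuous].
apply: eq_Rintegral => x _; rewrite /dot !sum_ord3 /T /curl.
have -> : (0 + 1 : 'I_3) = 1 by exact: val_inj.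
have -> : (0 + 2%:R : 'I_3) = 2%:R by exact: val_inj.
have -> : (1 + 1 : 'I_3) = 2%:R by exact: val_inj.
have -> : (1 + 2%:R : 'I_3) = 0 by exact: val_inj.
have -> : (2%:R + 1 : 'I_3) = 0 by exact: val_inj.
have -> : (2%:R + 2%:R : 'I_3) = 1 by exact: val_inj.
pose dF j k := 'D_(axis_vec R j) (F k) x; pose dphi j k := 'D_(axis_vec R j) (phi k) x.
rewrite -!/(dF _ _) -!/(dphi _ _).
move: (dF 0 1) (dF 0 2%:R) (dF 1 0) (dF 1 2%:R) (dF 2%:R 0) (dF 2%:R 1).
move: (dphi 0 1) (dphi 0 2%:R) (dphi 1 0) (dphi 1 2%:R) (dphi 2%:R 0) (dphi 2%:R 1).
move: (F 0 x) (F 1 x) (F 2%:R x) (phi 0 x) (phi 1 x) (phi 2%:R x) => *.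
ring.
Qed.

End CurlByParts.

(** * The fundamental lemma of the calculus of variations *)

Section BoxesGenerate.
Variable R : realType.

Definition oboxes : set (set (R3m R)) := [set A | exists a b, A = obox a b].

Lemma oboxI (a b a' b' : 'I_3 -> R) : obox a b `&` obox a' b' =
  obox (fun i => Num.max (a i) (a' i)) (fun i => Num.min (b i) (b' i)).
Proof.
apply/seteqP; split => [x [h h'] i|x h].
  by rewrite gt_max lt_min; have /andP[-> ->] := h i; have /andP[-> ->] := h' i.
by split => i; have := h i; rewrite gt_max lt_min => /andP[/andP[h1 h2] /andP[h3 h4]];
  apply/andP.
Qed.

Lemma oboxes_setI : setI_closed oboxes.
Proof. by move=> _ _ [a [b ->]] [a' [b' ->]]; rewrite oboxI; do 2 eexists. Qed.

Lemma slab_bigcup i (u v : R) : [set x : R3m R | u < pt_coord x i < v] =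
  \bigcup_n obox (fun j => if j == i then u else - n%:R) (fun j => if j == i then v else n%:R).
Proof.
apply/seteqP; split => [x uv|x [n _ /(_ i)]]; last by rewrite eqxx.
exists (Num.bound (\sum_j `|pt_coord x j|)) => // j; case: eqP => [->//|_].
rewrite -ltr_norml; apply: le_lt_trans (archi_boundP _).
  by rewrite (bigD1 j)//= lerDl sumr_ge0.
by rewrite sumr_ge0.
Qed.

Lemma measurable_coord_oboxes i :
  measurable_fun setT ((fun x => pt_coord x i) : g_sigma_algebraType oboxes -> measurableTypeR R).
Proof.
apply: (measurability _ (RGenOpens.measurableE R)).
move=> _ [_ [u [v ->]] <-]; rewrite setTI.
have -> : (fun x : R3m R => pt_coord x i) @^-1` `]u, v[ = [set x | u < pt_coord x i < v].
  by apply/seteqP; split => x /=; rewrite in_itv.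
rewrite slab_bigcup; apply: bigcupT_measurable => n; apply: sub_sigma_algebra.
by do 2 eexists.
Qed.

(** The identity is measurable from the sigma-algebra generated by boxes to the product one, because
    each coordinate is: a slab is a countable union of boxes. *)
Lemma measurable_sub_oboxes : (measurable : set (set (R3m R))) `<=` <<s oboxes >>.
Proof.
move=> A mA.
have m3 : measurable_fun setT ((fun x => (x.1.1, x.1.2, x.2)) : g_sigma_algebraType oboxes -> R3m R).
  apply: measurable_fun_pair; first apply: measurable_fun_pair.
  - exact: (measurable_coord_oboxes 0).
  - exact: (measurable_coord_oboxes 1).
  - exact: (measurable_coord_oboxes 2%:R).
have := m3 measurableT A mA; rewrite setTI.
by rewrite (_ : _ @^-1` A = A)//; apply/seteqP; split => -[[x y] z].
Qed.

End BoxesGenerate.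

(** * Integrable functions with null integral over all boxes *)

Section NullIntegrals.
Variables (R : realType) (al be : 'I_3 -> R) (f : R3m R -> R).
Local Notation Q := (obox al be : set (R3m R)).
Hypothesis intf : (lebesgue3 R).-integrable Q (EFin \o f).
Hypothesis f0 : forall a b, (forall i, al i <= a i /\ a i < b i /\ b i <= be i) ->
  (\int[lebesgue3 R]_(x in obox a b) (f x)%:E = 0)%E.

Let mQ : measurable Q := @measurable_obox R al be.

(** Intersecting with [Q] keeps [f] integrable on the set considered, so the whole space can belong
    to this lambda-system and signed integrals may be subtracted. *)
Let null (A : set (R3m R)) :=
  measurable A /\ (\int[lebesgue3 R]_(x in Q `&` A) (f x)%:E = 0)%E.

Let null_obox : @oboxes R `<=` null.
Proof.
move=> _ [a [b ->]]; split; first exact: measurable_obox.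
rewrite oboxI; case: (pselect (forall i, Num.max (al i) (a i) < Num.min (be i) (b i))) => h.
  by apply: f0 => i; rewrite le_max ge_min !lexx.
rewrite (_ : obox _ _ = set0) ?integral_set0//.
by apply/seteqP; split => // x hx; apply: h => i; have /andP[/lt_trans] := hx i; apply.
Qed.

Let null_setSD : setSD_closed null.
Proof.
move=> A B BA [mA A0] [mB B0]; split; first exact: measurableD.
have mQA := measurableI _ _ mQ mA; have mQB := measurableI _ _ mQ mB.
have mQD := measurableI _ _ mQ (measurableD mA mB).
have iQA : (lebesgue3 R).-integrable (Q `&` A) (EFin \o f) by apply: integrableS intf.
have E : Q `&` A = (Q `&` (A `\` B)) `|` (Q `&` B) by rewrite -setIUr setDKU.
move: A0; rewrite [in X in X -> _]E integral_setU//.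
- by move=> /=; rewrite B0 adde0.
- by rewrite -E; exact: measurable_int iQA.
- by rewrite disj_set2E -setIIr setDKI setI0.
Qed.

Let null_lambda : lambda_system setT null.
Proof.
split => //.
- split; first exact: measurableT.
  have [_] : null (obox al be) by apply: null_obox; do 2 eexists.
  by rewrite setIid setIT.
- move=> A ndA nA; have mA n : measurable (A n) by have [] := nA n.
  split; first exact: bigcupT_measurable.
  have nS n : null (seqD A n).
    case: n => [|n] /=; first exact: nA.
    by apply: null_setSD => //; exact/subsetPset/ndA.
  rewrite -eq_bigcup_seqD setI_bigcupr integral_bigcup.
  - by apply: eseries0 => n _ _; have [] := nS n.
  - by apply: trivIset_setIl; exact: trivIset_seqD.
  - by move=> n; apply: measurableI => //; have [] := nS n.
  - rewrite -setI_bigcupr; apply: integrableS intf => //.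
    by apply: measurableI => //; apply: bigcupT_measurable => n; have [] := nS n.
Qed.

(** Boxes form a pi-system, so the integral vanishes over every measurable subset of [Q], and [f]
    agrees almost everywhere with 0. *)
Lemma ae_eq0_of_null_boxes : {ae lebesgue3 R, forall x, Q x -> f x = 0}.
Proof.
have nullE A : measurable A -> (\int[lebesgue3 R]_(x in Q `&` A) (f x)%:E = 0)%E.
  move=> /measurable_sub_oboxes mA.
  have := lambda_system_subset (@oboxes_setI R) null_lambda null_obox.
  by move=> /(_ (fun X _ => @subsetT _ X)) /(_ A mA) [].
have := @integral_ae_eq _ _ _ (lebesgue3 R) Q mQ (cst 0%E) (EFin \o f) intf.
move=> /(_ (measurable_cst _)) H.
have : ae_eq (lebesgue3 R) Q (EFin \o f) (cst 0%E).
  apply: H => E EQ mE; rewrite integral0.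
  by rewrite -(nullE _ mE) (setIidr EQ).
by apply: filterS => x /= h Qx; have [] := h Qx.
Qed.

End NullIntegrals.

Section TestFieldsSeparate.
Variables (R : realType) (Om : region R).
Hypothesis wf : wf_region Om.

Local Notation D := (carrier Om : set (R3m R)).

Let mD : measurable D := measurable_carrier wf.

(** Dominated convergence with dominating function [|f|]: the cut-offs are bounded by 1 and tend to
    the indicator of the box. *)
Lemma cutoff_null_box (f : R3m R -> R) (H : 'I_3 -> R3 R -> R) a b :
  (lebesgue3 R).-integrable D (EFin \o f) ->
  (forall k i, Ck k (H i)) ->
  obox a b `<=` carrier Om ->
  (forall x, carrier Om x -> (forall i, 0 < H i x) <-> obox a b x) ->
  (forall n, \int[lebesgue3 R]_(x in carrier Om) (f x * cutoff H n x) = 0) ->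
  (\int[lebesgue3 R]_(x in obox a b) (f x)%:E = 0)%E.
Proof.
move=> iF cH abD HE f0.
have mf : measurable_fun D f by apply/measurable_EFinP; exact: measurable_int iF.
have mab : measurable (obox a b : set (R3m R)) := @measurable_obox R a b.
have mc n : measurable_fun D (cutoff H n : R3m R -> R).
  by apply: continuous_measurable3; exact: (@Ck_cutoff R 0%N).
have mfc n : measurable_fun D (fun x => (f x * cutoff H n x)%:E).
  by apply/measurable_EFinP; exact: measurable_funM.
have le_f n x : (`|(f x * cutoff H n x)%:E| <= `|(f x)%:E|)%E.
  by rewrite /= lee_fin normrM ler_piMr// cutoff_norm_le1.
have ifc n : (lebesgue3 R).-integrable D (fun x => (f x * cutoff H n x)%:E).
  by apply: le_integrable iF => // x _; exact: le_f.
have [] := @dominated_convergence _ _ _ (lebesgue3 R) D mD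
  (fun n x => (f x * cutoff H n x)%:E) ((EFin \o f) \_ (obox a b)) (fun x => `|(f x)%:E|%E).
- exact: mfc.
- apply/measurable_restrict => //; apply: measurable_funS (measurable_int _ iF) => //.
- apply: aeW => x Dx.
  have c : f x * cutoff H n x @[n --> \oo] --> f x * [forall i, 0 < H i x]%:R.
    by apply: cvgMr; exact: cutoff_cvg.
  have -> : ((EFin \o f) \_ (obox a b)) x = (f x * [forall i, 0 < H i x]%:R)%:E.
    rewrite patchE; case: ifPn => [|]; rewrite ?inE ?notin_setE => h.
      by rewrite (_ : [forall i, _] = true) ?mulr1//; apply/forallP => i; exact: (HE x Dx).2.
    rewrite (_ : [forall i, _] = false) ?mulr0//; apply/negbTE; apply/negP => /forallP.
    by move=> /(HE x Dx).1.
  by apply: cvg_EFin; [exact: nearW|exact: c].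
- exact: integrable_abse.
- by apply: aeW => x n _; exact: le_f.
move=> _ _; rewrite -integral_mkcondr (setIidr abD).
have -> : [sequence (\int[lebesgue3 R]_(x in D) (f x * cutoff H n x)%:E)%E]_n = cst 0%E.
  apply/funext => n /=; rewrite -[LHS]fineK ?integrable_fin_num//.
  by congr EFin; exact: f0.
by move=> /cvg_lim <- //; rewrite lim_cst.
Qed.

End TestFieldsSeparate.

(** * Test fields determine a square-integrable field *)

Section FundamentalLemma.
Variables (R : realType) (Om : region R).
Hypothesis wf : wf_region Om.
Implicit Types (a b : 'I_3 -> R) (x : R3 R) (F : vfield R).

(* On the torus the half angle makes the product [edge (x - a) * edge (b - x)]
   2 pi-periodic in [x]. *)
Definition edge (t : R) : R := if Om is Torus then sin (t / 2) else t.

Definition wall a b (i : 'I_3) x : R :=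
  edge (pt_coord x i - a i) * edge (b i - pt_coord x i).

Definition bump a b n (j : 'I_3) : vfield R :=
  fun i x => if i == j then cutoff (wall a b) n x else 0.

(** Written as shifts by [pi / 2], the derivatives of the sine form the sequence that [Ck_comp]
    takes. *)
Lemma is_derive_sin_shift m (t : R) :
  is_derive t 1 (fun t => sin (t + pi / 2 *+ m)) (sin (t + pi / 2 *+ m.+1)).
Proof.
rewrite [_ *+ m.+1]mulrSr addrA sinDpihalf -[cos _]mulr1.
apply: (@is_derive1_comp _ (@sin R) (fun t => t + pi / 2 *+ m)).
have d : is_derive t 1 (id \+ cst (pi / 2 *+ m)) (1 + 0 : R) by exact: is_deriveD.
by rewrite addr0 in d.
Qed.

Lemma Ck_edge k (h : R3 R -> R) : Ck k h -> Ck k (fun x => edge (h x)).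
Proof.
rewrite /edge; case: Om => // ch.
have -> : (fun x => sin (h x / 2)) =
    (fun t => sin (t + pi / 2 *+ 0)) \o (fun x => h x * cst 2^-1 x).
  by apply/funext => x /=; rewrite mulr0n addr0.
apply: (@Ck_comp _ (fun m (t : R) => sin (t + pi / 2 *+ m)) _ 0%N).
  exact: is_derive_sin_shift.
by apply: CkM => //; exact: Ck_cst.
Qed.

Lemma Ck_wall k a b i : Ck k (wall a b i).
Proof.
apply: CkM; apply: Ck_edge; apply: CkD.
- exact: Ck_coord.
- exact: Ck_cst.
- exact: Ck_cst.
- have -> : (fun x : R3 R => - pt_coord x i) = (fun x => cst (-1) x * pt_coord x i).
    by apply/funext => x; rewrite mulN1r.
  by apply: CkM; [exact: Ck_cst|exact: Ck_coord].
Qed.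

(** On the torus the half angles stay in [[- pi, pi]], where the sine has the sign of its
    argument. *)
Lemma wall_gt0 a b i x : a i < b i -> carrier Om x ->
  (if Om is Torus then - pi <= a i /\ b i <= pi else True) ->
  (0 < wall a b i x) = (a i < pt_coord x i < b i).
Proof.
rewrite /wall /edge; case: Om => [/= ab /(_ i) /andP[x1 x2] [a1 b1]|U /= ab _ _].
  set y := pt_coord x i in x1 x2 *.
  have [/andP[ay yb]|] := boolP (a i < y < b i).
    by apply: mulr_gt0; apply: sin_gt0_pi; apply/andP; split; lra.
  rewrite negb_and -!leNgt => /orP[ya|by_]; apply/negbTE; rewrite -leNgt.
    rewrite -[_ / 2]opprK sinN mulNr oppr_le0.
    by apply: mulr_ge0; apply: sin_ge0_pi; apply/andP; split; lra.
  rewrite -[X in sin _ * sin X]opprK sinN mulrN oppr_le0.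
  by apply: mulr_ge0; apply: sin_ge0_pi; apply/andP; split; lra.
set y := pt_coord x i.
have [/andP[ay yb]|] := boolP (a i < y < b i).
  by apply: mulr_gt0; rewrite subr_gt0.
rewrite negb_and -!leNgt => /orP[ya|by_]; apply/negbTE; rewrite -leNgt; nra.
Qed.

(** Here [x] ranges over the whole space, as the support of a bump on a domain requires. *)
Lemma wall_le0 U a b i x : Om = Domain U -> a i < b i ->
  ~~ (a i < pt_coord x i < b i) -> wall a b i x <= 0.
Proof.
move=> OmU ab; rewrite /wall /edge OmU; set y := pt_coord x i.
by rewrite negb_and -!leNgt => /orP[ya|by_]; nra.
Qed.

Lemma smooth_bump a b n j : smooth (bump a b n j).
Proof.
move=> k i; rewrite /bump; case: (i == j); last exact: (Ck_cst k 0).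
by apply: Ck_cutoff => l; exact: Ck_wall.
Qed.

Lemma periodic_bump a b n j : Om = Torus -> periodic2pi (bump a b n j).
Proof.
move=> OmT i l x; rewrite /bump; case: (i == j) => //.
rewrite /cutoff; apply: eq_bigr => m _; congr (flat 1 (_ * _)).
rewrite /wall /edge OmT pt_coordD pt_coordZ pt_coord_axis.
case: (l == m); last by rewrite mulr0 addr0.
rewrite mulr1; set y := pt_coord x m.
have -> : (y + 2 * pi - a m) / 2 = (y - a m) / 2 + pi by field.
have -> : (b m - y) / 2 = (b m - (y + 2 * pi)) / 2 + pi by field.
by rewrite !sinDpi mulrN mulNr.
Qed.

Lemma test_bump a b n j : (forall i, a i < b i) -> 
  (if Om is Domain U then cbox a b `<=` U else True) -> test_field Om (bump a b n j).
Proof.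
move=> ab; have sm := smooth_bump a b n j; have per := @periodic_bump a b n j.
have wl := wall_le0.
move: sm per wl; rewrite /test_field; case: Om => [sm per _ _|U sm _ wl abU].
  by split => //; exact: per.
split => //; exists (cbox a b); split => //; first exact: compact_cbox.
move=> i x nx; rewrite /bump; case: (i == j) => //.
have [m hm] : exists m, ~~ (a m < pt_coord x m < b m).
  apply: contrapT => h; apply: nx; apply: obox_sub_cbox => m.
  by apply: contrapT => hm; apply: h; exists m; exact/negP.
exact: (cutoff_eq0 _ (wl U a b m x erefl (ab m) hm)).
Qed.

(** On the torus a box may reach the faces of the cell, periodicity taking care of them; on a domain
    the closed box must stay inside to serve as a compact support. *)
Let admissible a b := (forall i, a i < b i) /\
  match Om with
  | Torus => forall i, - pi <= a i /\ b i <= pi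
  | Domain U => cbox a b `<=` U
  end.

Let admissible_sub a b : admissible a b -> obox a b `<=` carrier Om.
Proof.
rewrite /admissible; case: Om => [[_ h] x hx i|U [_ h]].
  by have /andP[h1 h2] := hx i; have [h3 h4] := h i; apply/andP; split; lra.
exact: subset_trans (@obox_sub_cbox R a b) h.
Qed.

(** The region has finite measure, so the constant 1 is square-integrable and [F i] may be
    multiplied by it. *)
Lemma L2_integrable F i : L2 Om F -> (lebesgue3 R).-integrable (carrier Om) (EFin \o F i).
Proof.
move=> LF; have [mF F2] := LF i.
have c1 : continuous (cst 1 : R3 R -> R) by move=> x; exact: cvg_cst.
have [m1 i1] := L2_continuous wf (F := fun _ => cst 1) (fun _ => c1) i.
have := integrable_mul wf mF m1 F2 i1.
apply: eq_integrable => //; first exact: measurable_carrier.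
by move=> x _; rewrite mulr1.
Qed.

Variable F : vfield R.
Hypothesis LF : L2 Om F.
Hypothesis F0 : forall phi, test_field Om phi -> inner Om F phi = 0.

Let null_box a b j : admissible a b ->
  (\int[lebesgue3 R]_(x in obox a b) (F j x)%:E = 0)%E.
Proof.
move=> adm; have [ab Omab] := adm.
apply: (cutoff_null_box wf (H := wall a b)).
- exact: L2_integrable.
- by move=> k i; exact: Ck_wall.
- exact: admissible_sub.
- move=> x Dx; have h i : (0 < wall a b i x) = (a i < pt_coord x i < b i).
    apply: wall_gt0 => //; move: adm; rewrite /admissible.
    by case: Om => [[_]|//]; apply.
  by split => hx i; have := hx i; rewrite h.
move=> n; have tb : test_field Om (bump a b n j).
  apply: test_bump => //; move: adm; rewrite /admissible.
  by case: Om => [//|U []].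
rewrite -[RHS](F0 tb); apply: eq_Rintegral => x _.
rewrite /dot (bigD1 j)//= /bump eqxx big1 ?addr0// => i ij.
by rewrite (negbTE ij) mulr0.
Qed.

Let ae_box a b j : admissible a b ->
  {ae lebesgue3 R, forall x : R3m R, obox a b x -> F j x = 0}.
Proof.
move=> adm; apply: ae_eq0_of_null_boxes.
  apply: integrableS (L2_integrable j LF).
  - exact: measurable_carrier.
  - exact: measurable_obox.
  - exact: admissible_sub.
move=> a' b' h; apply: null_box; split; first by move=> i; have [_ []] := h i.
move: adm; rewrite /admissible; case: Om => [[_ hpi] i|U [_ abU]].
  by have [h1 h2] := hpi i; have [h3 [h4 h5]] := h i; split; lra.
apply: subset_trans abU => x hx i; have [h3 [h4 h5]] := h i.
by have /andP[h1 h2] := hx i; apply/andP; split; lra.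
Qed.

Let ae_filter : Filter (nbhs (almost_everywhere (lebesgue3 R))).
Proof. exact: ae_filter_ringOfSetsType. Qed.

Lemma ae_coord_neq (i : 'I_3) (c : R) : {ae lebesgue3 R, forall x : R3m R, pt_coord x i != c}.
Proof.
pose A (j : 'I_3) : set (measurableTypeR R) := if j == i then [set c] else setT.
have mA j : measurable (A j) by rewrite /A; case: ifP.
exists ((A 0 `*` A 1) `*` A 2%:R); split.
- by apply: measurableX => //; exact: measurableX.
- rewrite lebesgue3X// /A.
  by move: (i); apply: forall_ord3; rewrite /= lebesgue_measure_set1 ?mule0 ?mul0e.
- move=> x /= /negP; rewrite negbK => /eqP xc.
  have h j : A j (pt_coord x j) by rewrite /A; case: eqP => [->|].
  by split; [split; [exact: (h 0)|exact: (h 1)]|exact: (h 2%:R)].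
Qed.

Lemma test_fields_separate j :
  {ae lebesgue3 R, forall x : R3m R, carrier Om x -> F j x = 0}.
Proof.
case OmE: Om => [|U].
  (* The open cell misses only the faces of the torus cell, which are null, so one box suffices. *)
  have adm : admissible (fun=> - pi) (fun=> pi).
    by rewrite /admissible OmE; split => // i; rewrite gtrN// pi_gt0.
  have nbd c : {ae lebesgue3 R, forall x : R3m R, forall i, pt_coord x i != c}.
    apply: filterS3 (ae_coord_neq 0 c) (ae_coord_neq 1 c) (ae_coord_neq 2%:R c) => x ? ? ?.
    exact: forall_ord3.
  apply: filterS3 (nbd (- pi)) (nbd pi) (ae_box j adm) => x n1 n2 h hx; apply: h => i.
  by rewrite !lt_neqAle eq_sym n1 n2 /=; exact: hx.
have oU : open U by move: wf; rewrite OmE => -[].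
(* On a domain, countably many rational boxes cover [U], and their exceptional null sets may be
   united. *)
pose P (q : {ffun 'I_3 -> rat * rat}) (x : R3m R) :=
  cbox (rat_lo R q) (rat_hi R q) `<=` U -> obox (rat_lo R q) (rat_hi R q) x -> F j x = 0.
have aeP q : {ae lebesgue3 R, forall x : R3m R, P q x}.
  case: (pselect (admissible (rat_lo R q) (rat_hi R q))) => [adm|nadm].
    by apply: filterS (ae_box j adm) => x h _; exact: h.
  apply: aeW => x qU xq; exfalso; apply: nadm; rewrite /admissible OmE; split => // i.
  by have /andP[/lt_trans] := xq i; apply.
have aePn : {ae lebesgue3 R, forall x : R3m R, forall n,
    if unpickle n is Some q then P q x else True}.
  by apply: ae_foralln => n; case: (unpickle n) => [q|]; [exact: aeP|exact: aeW].
apply: filterS aePn => x h Ux; have [q qU xq] := open_rat_box oU Ux.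
by have := h (pickle q); rewrite pickleK => /(_ qU xq).
Qed.

End FundamentalLemma.

(** * Constrained first variation *)

Section SmallPerturbation.
Variable R : realType.
Implicit Types (s p q al be ga : R).

(* The root of [ga p^2 + 2 (1 + s be) p + s^2 al] that is [O(s^2)], written
   [p = s^2 P] with [P] bounded. *)
Lemma small_root al be ga : exists2 s0, 0 < s0 & forall s, `|s| <= s0 ->
  exists2 P, `|P| <= 2 * `|al| &
    ga * (s ^+ 2 * P) ^+ 2 + 2 * (1 + s * be) * (s ^+ 2 * P) + s ^+ 2 * al = 0.
Proof.
(* For [|s| <= 1 / (2 k)] the half linear coefficient [b] is at least 1/2, and [s^2 |ga al| <= 1/4]
   keeps the discriminant nonnegative. *)
pose k := 1 + `|be| + `|ga * al|.
have be0 := normr_ge0 be; have ga0 := normr_ge0 (ga * al).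
have k1 : 1 <= k by rewrite /k; lra.
exists (2 * k)^-1 => [|s hs]; first by rewrite invr_gt0 mulr_gt0// (lt_le_trans ltr01).
have sk : `|s| * k <= 1 / 2.
  rewrite -ler_pdivlMr ?(lt_le_trans ltr01)//; apply: le_trans hs _.
  by rewrite invfM mul1r mulrC.
have s_half : `|s| <= 1 / 2 by apply: le_trans sk; rewrite ler_peMr.
have sbe : `|s * be| <= 1 / 2.
  rewrite normrM; apply: le_trans sk; rewrite ler_wpM2l// /k; lra.
have sga : `|s ^+ 2 * (ga * al)| <= 1 / 4.
  rewrite normrM normrX expr2 -mulrA.
  have h : `|s| * `|ga * al| <= 1 / 2.
    by apply: le_trans sk; rewrite ler_wpM2l// /k; lra.
  have := ler_pM (normr_ge0 _) (mulr_ge0 (normr_ge0 _) (normr_ge0 _)) s_half h.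
  by move/le_trans; apply; lra.
set b := 1 + s * be.
have b2 : 1 / 2 <= b by move: sbe; rewrite ler_norml /b => /andP[? ?]; lra.
set De := b ^+ 2 - s ^+ 2 * (ga * al).
have De0 : 0 <= De by move: sga; rewrite ler_norml /De => /andP[? ?]; nra.
have r0 := sqrtr_ge0 De; have rE := sqr_sqrtr De0.
set r := Num.sqrt De in r0 rE.
have e2 : 1 / 2 <= b + r by lra.
have e0 : b + r != 0 by rewrite gt_eqF//; lra.
(* The root [(- b + r) / ga] in rationalised form: it makes sense for [ga = 0] and shows the factor
   [s^2]. The bound follows from [b + r >= 1/2]. *)
exists (- al / (b + r)).
  rewrite normrM normrN normfV mulrC ler_wpM2r//.
  rewrite -[leRHS]invrK lef_pV2 ?posrE ?normr_gt0 ?invr_gt0//.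
  by apply: le_trans (ler_norm _); lra.
have -> : ga * (s ^+ 2 * (- al / (b + r))) ^+ 2 + 2 * b * (s ^+ 2 * (- al / (b + r))) + s ^+ 2 * al
  = s ^+ 2 * al / (b + r) ^+ 2 * (r ^+ 2 - De) by rewrite /De; field.
by rewrite rE subrr mulr0.
Qed.

(** Once [p] and [q] are the roots of order [s^2], every term except [2 s e1] is at most [L s^2]; a
    small [s] of sign opposite to [e1] would make the sum negative. *)
Lemma first_order_eq0 (al be ga al' be' ga' e1 e2 e3 K : R) (N : R -> R -> R -> R) :
  (forall s p q, N s p q <= K * (s ^+ 2 + p ^+ 2 + q ^+ 2)) ->
  (forall s p q,
     ga * p ^+ 2 + 2 * (1 + s * be) * p + s ^+ 2 * al = 0 ->
     ga' * q ^+ 2 + 2 * (1 + s * be') * q + s ^+ 2 * al' = 0 ->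
     0 <= 2 * (s * e1 + p * e2 + q * e3) + N s p q) ->
  e1 = 0.
Proof.
move=> NK pos.
have [s0 s00 h] := small_root al be ga; have [s0' s00' h'] := small_root al' be' ga'.
pose M := 2 * `|al|; pose M' := 2 * `|al'|.
pose L := 2 * (M * `|e2| + M' * `|e3|) + `|K| * (1 + M ^+ 2 + M' ^+ 2).
have M0 : 0 <= M by apply: mulr_ge0.
have M0' : 0 <= M' by apply: mulr_ge0.
have L0 : 0 <= L.
  by rewrite /L addr_ge0// mulr_ge0// ?addr_ge0 ?mulr_ge0 ?sqr_ge0.
have bound s : `|s| <= s0 -> `|s| <= s0' -> `|s| <= 1 -> 0 <= 2 * (s * e1) + s ^+ 2 * L.
  move=> /h[P PM P0] /h'[P' PM' P0'] s1.
  have := pos _ _ _ P0 P0'; move/le_trans; apply.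
  have s2 : 0 <= s ^+ 2 <= 1 by rewrite sqr_ge0 -real_normK ?num_real// expr_le1.
  have := NK s (s ^+ 2 * P) (s ^+ 2 * P').
  have Kle : K <= `|K| := ler_norm K.
  have Pe : P * e2 <= M * `|e2|.
    by apply: le_trans (ler_norm _) _; rewrite normrM ler_wpM2r.
  have Pe' : P' * e3 <= M' * `|e3|.
    by apply: le_trans (ler_norm _) _; rewrite normrM ler_wpM2r.
  have P2 : P ^+ 2 <= M ^+ 2 by rewrite -real_normK ?num_real// lerXn2r ?nnegrE.
  have P2' : P' ^+ 2 <= M' ^+ 2 by rewrite -real_normK ?num_real// lerXn2r ?nnegrE.
  set t := s ^+ 2 in s2 *; have /andP[t0 t1] := s2.
  have tt (X Y : R) : X ^+ 2 <= Y -> (t * X) ^+ 2 <= Y * t.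
    move=> XY; rewrite exprMn expr2 -mulrA mulrC ler_wpM2r//.
    by apply: le_trans XY; rewrite ler_piMl ?sqr_ge0.
  have S1 := tt _ _ P2; have S2 := tt _ _ P2'.
  have S0 : 0 <= t + (t * P) ^+ 2 + (t * P') ^+ 2 by rewrite !addr_ge0 ?sqr_ge0.
  have KS := ler_wpM2r S0 Kle.
  have SK : `|K| * (t + (t * P) ^+ 2 + (t * P') ^+ 2) <= `|K| * (t * (1 + M ^+ 2 + M' ^+ 2)).
    by apply: ler_wpM2l => //; lra.
  have T1 := ler_wpM2l t0 Pe; have T2 := ler_wpM2l t0 Pe'.
  rewrite /L; move: (N _ _ _) => n Nn.
  have -> : t * (2 * (M * `|e2| + M' * `|e3|) + `|K| * (1 + M ^+ 2 + M' ^+ 2)) =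
    2 * (t * (M * `|e2|) + t * (M' * `|e3|)) + `|K| * (t * (1 + M ^+ 2 + M' ^+ 2)) by ring.
  have -> : 2 * (s * e1 + t * P * e2 + t * P' * e3) =
    2 * (s * e1) + 2 * (t * (P * e2) + t * (P' * e3)) by ring.
  move: (t * (P * e2)) (t * (P' * e3)) (t * (M * `|e2|)) (t * (M' * `|e3|)) T1 T2 => *.
  lra.
have [//|e10] := eqVneq e1 0.
have E0 : 0 < `|e1| by rewrite normr_gt0.
(* The last entry gives [t * L < |e1|], hence [- 2 t |e1| + t^2 L < 0]. *)
pose t := Num.min (Num.min s0 s0') (Num.min 1 (`|e1| / (L + 1))).
have t0 : 0 < t by rewrite !lt_min s00 s00' ltr01 divr_gt0// ltr_wpDl.
have tL : t * (L + 1) <= `|e1| by rewrite -ler_pdivlMr ?ltr_wpDl// /t !ge_min lexx !orbT.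
have tn : `|- Num.sg e1 * t| = t by rewrite normrM normrN normr_sg e10 mul1r gtr0_norm.
have := bound (- Num.sg e1 * t); rewrite tn {1 2 3}/t !ge_min !lexx !orbT => /(_ isT isT isT).
have -> : (- Num.sg e1 * t) ^+ 2 = t ^+ 2 by rewrite -real_normK ?num_real// tn.
have -> : - Num.sg e1 * t * e1 = - (t * `|e1|) by rewrite [in RHS]normrEsg; ring.
by nra.
Qed.

End SmallPerturbation.

(** * Variations of the helicities and of the energy *)

Section Variations.
Variables (R : realType) (Om : region R).
Hypothesis wf : wf_region Om.
Implicit Types (A B F G a v : vfield R) (s p q : R).

Lemma test_fieldD F G : test_field Om F -> test_field Om G -> test_field Om (vadd F G).
Proof.
move=> tF tG; have s : smooth (vadd F G).
  by move=> k i; apply: CkD; [exact: (test_field_smooth tF)|exact: (test_field_smooth tG)].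
move: tF tG; case: Om => [[_ pF] [_ pG]|U [_ [K [cK KU K0]]] [_ [K' [cK' KU' K0']]]].
  by split => // i j x; rewrite /vadd pF pG.
split => //; exists (K `|` K'); split; first exact: compactU.
  by rewrite subUset.
by move=> i x /not_orP[h h']; rewrite /vadd K0// K0' ?addr0.
Qed.

Lemma test_fieldZ c F : test_field Om F -> test_field Om (vscale c F).
Proof.
move=> tF; have s : smooth (vscale c F).
  by move=> k i; apply: CkM; [exact: Ck_cst|exact: (test_field_smooth tF)].
move: tF; case: Om => [[_ pF]|U [_ [K [cK KU K0]]]].
  by split => // i j x; rewrite /vscale pF.
by split => //; exists K; split => // i x h; rewrite /vscale K0 ?mulr0.
Qed.

Lemma test_field_bcW F : test_field Om F -> test_field_bc Om F.
Proof. by case: Om => [//|U []]. Qed.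

Lemma curlD F G : smooth F -> smooth G -> curl (vadd F G) = vadd (curl F) (curl G).
Proof.
move=> sF sG; apply/funext => i; apply/funext => x; rewrite /curl.
have dD k j : 'D_(axis_vec R j) (vadd F G k) x =
    'D_(axis_vec R j) (F k) x + 'D_(axis_vec R j) (G k) x.
  by apply: deriveD; exact: smooth_derivable.
by rewrite !dD /vadd opprD addrACA.
Qed.

Lemma curlZ c F : smooth F -> curl (vscale c F) = vscale c (curl F).
Proof.
move=> sF; apply/funext => i; apply/funext => x; rewrite /curl.
have dZ k j : 'D_(axis_vec R j) (vscale c F k) x = c * 'D_(axis_vec R j) (F k) x.
  by apply: deriveZ; exact: smooth_derivable.
by rewrite !dZ /vscale mulrBr.
Qed.

Lemma L2_test F : test_field Om F -> L2 Om F.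
Proof.
move=> tF; apply: L2_continuous => // i; exact: (smooth_continuous (test_field_smooth tF)).
Qed.

Lemma L2_curl_test F : test_field Om F -> L2 Om (curl F).
Proof.
move=> tF; apply: L2_continuous => // i; exact: (smooth_curl_continuous (test_field_smooth tF)).
Qed.

Lemma potential_test F : test_field Om F -> potential Om (curl F) F.
Proof. by move=> tF; split; [exact: L2_test|exact: is_curl_bc_test]. Qed.

Lemma L2_test_bc F : test_field_bc Om F -> L2 Om F.
Proof.
move=> tF; apply: L2_continuous => // i; exact: (smooth_continuous (test_field_bc_smooth tF)).
Qed.

Lemma L2_curl_test_bc F : test_field_bc Om F -> L2 Om (curl F).
Proof.
move=> tF; apply: L2_continuous => // i; exact: (smooth_curl_continuous (test_field_bc_smooth tF)).
Qed.

Lemma potentialD A B F G : L2 Om B -> L2 Om G ->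
  potential Om B A -> potential Om G F -> potential Om (vadd B G) (vadd A F).
Proof.
move=> LB LG [LA cA] [LF cF]; split; first exact: L2D.
move=> phi tphi.
rewrite innerDl//; last exact: L2_curl_test_bc.
rewrite innerDl//; last exact: L2_test_bc.
by rewrite cA// cF.
Qed.

Lemma helicity_shift A B a : L2 Om B -> potential Om B A -> test_field Om a ->
  inner Om (vadd A a) (vadd B (curl a)) =
  inner Om A B + 2 * inner Om B a + inner Om a (curl a).
Proof.
move=> LB [LA cA] ta; have La := L2_test ta; have Lc := L2_curl_test ta.
have cAa := cA a (test_field_bcW ta); move: (curl a) Lc cAa => c Lc cAa.
rewrite innerDl//; last exact: L2D.
rewrite !innerDr// cAa [inner Om a B]innerC; ring.
Qed.

Lemma energy_shift F G v c : L2 Om F -> L2 Om G -> L2 Om v -> L2 Om c ->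
  energy Om (vadd F v) (vadd G c) = energy Om F G +
  2 * (inner Om F v + inner Om G c) + (inner Om v v + inner Om c c).
Proof.
move=> LF LG Lv Lc; have LFv := L2D wf LF Lv; have LGc := L2D wf LG Lc.
rewrite !energyE// !innerDl// !innerDr// [inner Om v F]innerC [inner Om c G]innerC; ring.
Qed.

Lemma inner_ge0 F : 0 <= inner Om F F.
Proof.
apply: Rintegral_ge0 => x _; apply: sumr_ge0 => i _; by rewrite -expr2 sqr_ge0.
Qed.

(** The parallelogram identity, with the square of [F - G] dropped. *)
Lemma inner_add_le F G : L2 Om F -> L2 Om G ->
  inner Om (vadd F G) (vadd F G) <= 2 * inner Om F F + 2 * inner Om G G.
Proof.
move=> LF LG; have LNG := L2Z wf (-1) LG; have LB := L2D wf LF LNG; have LA := L2D wf LF LG.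
have := inner_ge0 (vadd F (vscale (-1) G)).
rewrite !innerDl// !innerDr// !innerZl// !innerZr// [inner Om G F]innerC; lra.
Qed.

Lemma innerZZ c F : L2 Om F -> inner Om (vscale c F) (vscale c F) = c ^+ 2 * inner Om F F.
Proof.
move=> LF; have LcF := L2Z wf c LF; rewrite innerZl// innerZr//; ring.
Qed.

Lemma ae_eq0_inner F G : L2 Om F -> L2 Om G ->
  (forall i, {ae lebesgue3 R, forall x : R3m R, carrier Om x -> G i x = 0}) ->
  inner Om F G = 0.
Proof.
move=> LF LG G0.
have FF : Filter (nbhs (almost_everywhere (lebesgue3 R))) by exact: ae_filter_ringOfSetsType.
have mD := measurable_carrier wf.
rewrite /inner /Rintegral (ae_eq_integral (cst 0%E)) ?integral0//.
  exact: measurable_int (integrable_dot wf LF LG).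
apply: filterS3 (G0 0) (G0 1) (G0 2%:R) => x h0 h1 h2 Dx.
rewrite /= /dot big1// => i _.
have /(_ i) -> := @forall_ord3 (fun i => G i x = 0) (h0 Dx) (h1 Dx) (h2 Dx).
by rewrite mulr0.
Qed.

Lemma test_field_pairing F G h : L2 Om F -> L2 Om G -> inner Om F G = h -> h != 0 ->
  exists2 a, test_field Om a & inner Om G a = 1.
Proof.
move=> LF LG hE h0; apply: contrapT => no; case/eqP: h0; rewrite -hE.
apply: ae_eq0_inner => // i; apply: test_fields_separate => // phi tphi.
have [//|n0] := eqVneq (inner Om G phi) 0; exfalso; apply: no.
exists (vscale (inner Om G phi)^-1 phi); first exact: test_fieldZ.
by rewrite innerZr ?mulVf//; exact: L2_test.
Qed.

End Variations.

(** * Criticality and the multipliers *)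

Section LagrangeMultipliers.
Variables (R : realType) (Om : region R) (h1 h2 : R) (B w u A u0 a1 v2 : vfield R).
Hypotheses (wf : wf_region Om) (LB : L2 Om B) (Lw : L2 Om w)
  (pA : potential Om B A) (pu0 : potential Om w u0) (pu : potential Om w u)
  (hA : inner Om A B = h1) (hAu : inner Om (vadd A u0) (vadd B w) = h2)
  (energy_min : forall B' w' u', helicity_class Om h1 h2 (B', w') ->
     potential Om w' u' -> energy Om u B <= energy Om u' B')
  (ta1 : test_field Om a1) (Ba1 : inner Om B a1 = 1)
  (tv2 : test_field Om v2) (Bwv2 : inner Om (vadd B w) v2 = 1).

(* Unification would otherwise unfold [curl a] into a sum of fields. *)
Local Opaque inner curl.

Let Lu : L2 Om u. Proof. by case: pu. Qed.
Let LBw : L2 Om (vadd B w). Proof. exact: L2D. Qed.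

Let energy_increment_ge0 a v : test_field Om a -> test_field Om v ->
  2 * inner Om B a + inner Om a (curl a) = 0 ->
  2 * inner Om (vadd B w) (vadd a v) + inner Om (vadd a v) (curl (vadd a v)) = 0 ->
  0 <= 2 * (inner Om u v + inner Om B (curl a)) +
       (inner Om v v + inner Om (curl a) (curl a)).
Proof.
move=> ta tv ha hav; have tav := test_fieldD ta tv.
have La := L2_test wf ta; have Lv := L2_test wf tv.
have Lca := L2_curl_test wf ta; have Lcv := L2_curl_test wf tv.
have pa := potential_test wf ta; have pv := potential_test wf tv.
have cav : curl (vadd a v) = vadd (curl a) (curl v).
  exact: curlD (test_field_smooth ta) (test_field_smooth tv).
have LB' := L2D wf LB Lca; have Lw' := L2D wf Lw Lcv.
have pA' := potentialD wf LB Lca pA pa; have pu0' := potentialD wf Lw Lcv pu0 pv.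
have vaddACA (F G F' G' : vfield R) :
    vadd (vadd F G) (vadd F' G') = vadd (vadd F F') (vadd G G').
  by apply/funext => i; apply/funext => x; rewrite /vadd addrACA.
(* The shifted [u0] witnesses the helicity constraint, while the shifted [u] enters the energy
   below. *)
have cls : helicity_class Om h1 h2 (vadd B (curl a), vadd w (curl v)).
  split => /=; first by split => //; exists (vadd A a).
    by split => //; exists (vadd u0 v).
  exists (vadd A a), (vadd u0 v); split => //.
    by rewrite (helicity_shift wf LB pA ta) -addrA ha addr0.
  have pAu := potentialD wf LB Lw pA pu0.
  rewrite vaddACA [X in inner Om _ X]vaddACA -cav.
  by rewrite (helicity_shift wf LBw pAu tav) -addrA hav addr0.
have := energy_min cls (potentialD wf Lw Lcv pu pv).
by rewrite (energy_shift wf Lu LB Lv Lca) -addrA lerDl.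
Qed.

Let critical a v : test_field Om a -> test_field Om v ->
  inner Om B a = 0 -> inner Om (vadd B w) (vadd a v) = 0 ->
  inner Om u v + inner Om B (curl a) = 0.
Proof.
move=> ta tv Ba0 Bav0; pose g := vadd a v; rewrite -/g in Bav0.
have tg : test_field Om g by exact: test_fieldD ta tv.
have La := L2_test wf ta; have Lv := L2_test wf tv; have Lg := L2_test wf tg.
have La1 := L2_test wf ta1; have Lv2 := L2_test wf tv2.
have Lca := L2_curl_test wf ta.
have Lca1 := L2_curl_test wf ta1; have Lcv2 := L2_curl_test wf tv2.
have Lcg := L2_curl_test wf tg.
pose a' s p := vadd (vscale s a) (vscale p a1).
pose v' s p q := vadd (vadd (vscale s v) (vscale (- p) a1)) (vscale q v2).
(* The terms in [a1] cancel in the sum, so the second constraint involves [s] and [q] only. *)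
have avE s p q : vadd (a' s p) (v' s p q) = vadd (vscale s g) (vscale q v2).
  by apply/funext => i; apply/funext => x; rewrite /a' /v' /g /vadd /vscale; ring.
have ta' s p : test_field Om (a' s p) by apply: test_fieldD; exact: test_fieldZ.
have tv' s p q : test_field Om (v' s p q).
  by apply: test_fieldD; [apply: test_fieldD|]; exact: test_fieldZ.
have curlE x y F G : test_field Om F -> test_field Om G ->
    curl (vadd (vscale x F) (vscale y G)) = vadd (vscale x (curl F)) (vscale y (curl G)).
  move=> tF tG; have tFx := test_fieldZ x tF; have tGy := test_fieldZ y tG.
  rewrite (curlD (test_field_smooth tFx) (test_field_smooth tGy)).
  by rewrite (curlZ _ (test_field_smooth tF)) (curlZ _ (test_field_smooth tG)).
have LZ x F : L2 Om F -> L2 Om (vscale x F) by exact: L2Z.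
have quad x y F G : L2 Om F -> L2 Om G -> forall F' G', L2 Om F' -> L2 Om G' ->
    inner Om (vadd (vscale x F) (vscale y G)) (vadd (vscale x F') (vscale y G')) =
    x ^+ 2 * inner Om F F' + x * y * (inner Om F G' + inner Om G F') + y ^+ 2 * inner Om G G'.
  move=> LF LG F' G' LF' LG'.
  have := L2D wf (LZ x _ LF') (LZ y _ LG') => LFG'.
  have := (LZ x _ LF, LZ y _ LG, LZ x _ LF', LZ y _ LG') => -[[[? ?] ?] ?].
  by rewrite innerDl// !innerDr// !innerZl// !innerZr//; ring.
have lin x y F G H : L2 Om F -> L2 Om G -> L2 Om H ->
    inner Om H (vadd (vscale x F) (vscale y G)) = x * inner Om H F + y * inner Om H G.
  by move=> LF LG LH; rewrite innerDr ?innerZr//; exact: LZ.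
(* The factors 4 come from splitting the three-term field [v'] in two stages, the factors 2 from a
   single split. *)
pose K := 4 * inner Om v v + 4 * inner Om a1 a1 + 2 * inner Om v2 v2
   + 2 * inner Om (curl a) (curl a) + 2 * inner Om (curl a1) (curl a1).
(* The cross coefficients are half sums of [<F, curl G>] and [<G, curl F>], the form in which they
   occur in the expanded constraint. *)
apply: (@first_order_eq0 _
  (inner Om a (curl a)) ((inner Om a (curl a1) + inner Om a1 (curl a)) / 2) (inner Om a1 (curl a1))
  (inner Om g (curl g)) ((inner Om g (curl v2) + inner Om v2 (curl g)) / 2) (inner Om v2 (curl v2))
  _ (- inner Om u a1 + inner Om B (curl a1)) (inner Om u v2) K
  (fun s p q => inner Om (v' s p q) (v' s p q) + inner Om (curl (a' s p)) (curl (a' s p)))).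
- move=> s p q; rewrite curlE//.
  have i1 := inner_add_le wf (L2D wf (LZ s _ Lv) (LZ (- p) _ La1)) (LZ q _ Lv2).
  have i2 := inner_add_le wf (LZ s _ Lv) (LZ (- p) _ La1).
  have i3 := inner_add_le wf (LZ s _ Lca) (LZ p _ Lca1).
  have pos := @inner_ge0 _ Om.
  rewrite !innerZZ// ?sqrrN in i1 i2 i3.
  have := (pos v, pos a1, pos v2, pos (curl a), pos (curl a1)) => -[[[[]]]].
  rewrite /v' /K.
  move: (inner Om v v) (inner Om a1 a1) (inner Om v2 v2) (inner Om (curl a) (curl a))
    (inner Om (curl a1) (curl a1)) i1 i2 i3 => V X Y C C1 i1 i2 i3 V0 X0 Y0 C0 C10.
  have := (sqr_ge0 s, sqr_ge0 p, sqr_ge0 q) => -[[]].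
  move: (s ^+ 2) (p ^+ 2) (q ^+ 2) i1 i2 i3 => S P Q i1 i2 i3 S0 P0 Q0.
  have m (x y : R) : 0 <= x -> 0 <= y -> 0 <= x * y by exact: mulr_ge0.
  have := (m _ _ V0 P0, m _ _ V0 Q0, m _ _ X0 S0, m _ _ X0 Q0, m _ _ Y0 S0, m _ _ Y0 P0,
    m _ _ C0 P0, m _ _ C0 Q0, m _ _ C10 S0, m _ _ C10 Q0).
  have := (m _ _ V0 S0, m _ _ X0 P0, m _ _ Y0 Q0, m _ _ C0 S0, m _ _ C10 P0).
  move: (inner Om _ _) (inner Om _ _) (inner Om _ _) i1 i2 i3 => n1 n2 n3 i1 i2 i3.
  move=> [[[[? ?] ?] ?] ?] [[[[[[[[[? ?] ?] ?] ?] ?] ?] ?] ?] ?].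
  lra.
move=> s p q Hp Hq.
have c1 : 2 * inner Om B (a' s p) + inner Om (a' s p) (curl (a' s p)) = 0.
  rewrite /a' (curlE _ _ _ _ ta ta1) (quad _ _ _ _ La La1 _ _ Lca Lca1).
  rewrite (lin _ _ _ _ _ La La1 LB) Ba0 Ba1 -[RHS]Hp.
  move: (inner Om a (curl a)) (inner Om a (curl a1)) (inner Om a1 (curl a)) (inner Om a1 (curl a1)) => *.
  by field.
have c2 : 2 * inner Om (vadd B w) (vadd (a' s p) (v' s p q)) +
    inner Om (vadd (a' s p) (v' s p q)) (curl (vadd (a' s p) (v' s p q))) = 0.
  rewrite avE (curlE _ _ _ _ tg tv2) (quad _ _ _ _ Lg Lv2 _ _ Lcg Lcv2).
  rewrite (lin _ _ _ _ _ Lg Lv2 LBw) Bav0 Bwv2 -[RHS]Hq.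
  move: (inner Om g (curl g)) (inner Om g (curl v2)) (inner Om v2 (curl g)) (inner Om v2 (curl v2)) => *.
  by field.
have := energy_increment_ge0 (ta' s p) (tv' s p q) c1 c2.
congr (0 <= 2 * _ + _).
rewrite (curlE _ _ _ _ ta ta1) (lin _ _ _ _ _ Lca Lca1 LB) /v'.
rewrite (innerDr wf Lu (L2D wf (LZ s _ Lv) (LZ (- p) _ La1)) (LZ q _ Lv2)).
rewrite (lin _ _ _ _ _ Lv La1 Lu) (innerZr wf q Lu Lv2).
move: (inner Om u v) (inner Om u a1) (inner Om u v2) (inner Om B (curl a)) (inner Om B (curl a1)) => *.
ring.
Qed.

(** Subtracting multiples of [(a1, - a1)] and [(0, v2)] projects an arbitrary [(a, v)] onto the
    kernel of both linear forms, where the first variation vanishes. *)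
Lemma lagrange_multipliers : exists l1 l2,
  (forall v, test_field Om v -> inner Om u v = l2 * inner Om (vadd B w) v) /\
  (forall a, test_field Om a -> inner Om B (curl a) = l1 * inner Om B a + inner Om u a).
Proof.
pose l1 := inner Om B (curl a1) - inner Om u a1; pose l2 := inner Om u v2.
have La1 := L2_test wf ta1; have Lv2 := L2_test wf tv2; have Lca1 := L2_curl_test wf ta1.
have LZ x F : L2 Om F -> L2 Om (vscale x F) by exact: L2Z.
have LD F G : L2 Om F -> L2 Om G -> L2 Om (vadd F G) by exact: L2D.
have main a v : test_field Om a -> test_field Om v ->
    inner Om u v + inner Om B (curl a) =
    l1 * inner Om B a + l2 * (inner Om (vadd B w) a + inner Om (vadd B w) v).
  move=> ta tv; set c := inner Om B a.
  set d := inner Om (vadd B w) a + inner Om (vadd B w) v.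
  have La := L2_test wf ta; have Lv := L2_test wf tv; have Lca := L2_curl_test wf ta.
  pose a' := vadd a (vscale (- c) a1).
  pose v' := vadd (vadd v (vscale c a1)) (vscale (- d) v2).
  have ta' : test_field Om a' by apply: test_fieldD => //; exact: test_fieldZ.
  have tv' : test_field Om v'.
    by apply: test_fieldD; [apply: test_fieldD => //|]; exact: test_fieldZ.
  have cE : curl a' = vadd (curl a) (vscale (- c) (curl a1)).
    rewrite (curlD (test_field_smooth ta) (test_field_smooth (test_fieldZ (- c) ta1))).
    by rewrite (curlZ _ (test_field_smooth ta1)).
  have L1 := LZ (- c) _ La1; have L2' := LZ c _ La1; have L3 := LZ (- d) _ Lv2.
  have L4 := LD _ _ Lv L2'; have L5 := LZ (- c) _ Lca1.
  have h1' : inner Om B a' = 0 by rewrite innerDr// innerZr// Ba1 mulr1 subrr.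
  have h2' : inner Om (vadd B w) (vadd a' v') = 0.
    rewrite innerDr//; [|exact: LD..].
    rewrite innerDr// [inner Om _ v']innerDr// [inner Om _ (vadd v _)]innerDr// !innerZr// Bwv2.
    rewrite /d; ring.
  have := critical ta' tv' h1' h2'.
  rewrite cE (innerDr wf LB Lca L5) (innerZr wf (- c) LB Lca1).
  rewrite (innerDr wf Lu L4 L3) (innerDr wf Lu Lv L2') (innerZr wf c Lu La1) (innerZr wf (- d) Lu Lv2).
  rewrite /l1 /l2 => e; apply/eqP; rewrite -subr_eq0 -[X in _ == X]e.
  by apply/eqP; move: (c) (d) (inner Om u v) (inner Om u a1) (inner Om u v2) (inner Om B (curl a))
    (inner Om B (curl a1)) => *; ring.
have zero F G : L2 Om F -> L2 Om G -> inner Om F (vscale 0 G) = 0.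
  by move=> LF LG; rewrite innerZr// mul0r.
exists l1, l2.
have uE v : test_field Om v -> inner Om u v = l2 * inner Om (vadd B w) v.
  move=> tv; have Lv := L2_test wf tv; have := main _ _ (test_fieldZ 0 tv) tv.
  rewrite (curlZ _ (test_field_smooth tv)) !zero//; last exact: L2_curl_test.
  by rewrite addr0 mulr0 !add0r.
(* With [v = 0] the second multiplier contributes [l2 <B + w, a>], which the first identity turns
   into [<u, a>]. *)
split => // a ta; have La := L2_test wf ta; have := main _ _ ta (test_fieldZ 0 ta).
by rewrite !zero// add0r addr0 -uE.
Qed.

End LagrangeMultipliers.

Theorem proposition2p1 (R : realType) (Om : region R) (h1 h2 : R)
    (B w u : vfield R) :
  wf_region Om -> h1 != 0 -> h2 != 0 ->
  is_minimizer Om h1 h2 B w u ->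
  exists (lambda1 lambda2 : R) (J : vfield R),
    [/\ L2 Om J, is_curl Om B J,
      {ae lebesgue3 R, forall x, carrier Om x ->
        forall i, u i x = lambda2 * (B i x + w i x)} &
      {ae lebesgue3 R, forall x, carrier Om x ->
        forall i, u i x - J i x = - lambda1 * B i x}].
Proof.
move=> wf h10 h20 [[[LB _] [Lw _] [A [u0 [pA pu0 hA hAu]]]] pu energy_min].
rewrite /= in LB Lw pA pu0 hA hAu.
have [LA _] := pA; have [Lu0 _] := pu0; have [Lu _] := pu.
have LBw := L2D wf LB Lw.
have [a1 ta1 Ba1] := test_field_pairing wf LA LB hA h10.
have [v2 tv2 Bwv2] := test_field_pairing wf (L2D wf LA Lu0) LBw hAu h20.
have [l1 [l2 [uE BE]]] :=
  lagrange_multipliers wf LB Lw pA pu0 pu hA hAu energy_min ta1 Ba1 tv2 Bwv2.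
exists l1, l2, (vadd (vscale l1 B) u); split.
- by apply: L2D => //; exact: L2Z.
(* The second multiplier identity, read with [phi] as test field, is the distributional curl of
   [B]. *)
- move=> phi tphi; have Lphi := L2_test wf tphi.
  by rewrite BE// innerDl ?innerZl//; exact: L2Z.
- have LF := L2D wf Lu (L2Z wf (- l2) LBw).
  have F0 phi : test_field Om phi -> inner Om (vadd u (vscale (- l2) (vadd B w))) phi = 0.
    move=> tphi; have Lphi := L2_test wf tphi.
    by rewrite innerDl ?innerZl ?uE ?mulNr ?subrr//; exact: L2Z.
  have ae0 := test_fields_separate wf LF F0.
  have ae_filter : Filter (nbhs (almost_everywhere (lebesgue3 R))).
    exact: ae_filter_ringOfSetsType.
  have : {ae lebesgue3 R, forall x : R3m R, carrier Om x ->
      forall i, u i x = l2 * (B i x + w i x)}.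
    apply: filterS3 (ae0 0) (ae0 1) (ae0 2%:R) => x h0 h1' h2' Dx.
    apply: forall_ord3; apply/eqP; rewrite -subr_eq0 -mulNr; apply/eqP;
      [exact: h0|exact: h1'|exact: h2'].
  exact.
- by apply: aeW => x _ i; rewrite /vadd /vscale; ring.
Qed.
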